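(* Let $\mathcal{P}\subset\mathbf{G}_d$ be a hyperfinite family. Then for every $\epsilon>0$ there exists an integer $K>0$ with the following property: for every $\delta>0$ there exists $f(\delta)>0$ such that if $G\in\mathcal{P}$ and $H\in\mathbf{G}_d$ satisfy $d_{stat}(G,H)\le f(\delta)$, then one can remove less than $2\epsilon|E(G)|$ edges of $G$ and less than $2\epsilon|E(H)|$ edges of $H$ such that, denoting the remaining graphs by $G'$ and $H'$, (1) all components of $G'$ and of $H'$ have size at most $K$; (2) $\sum_{S,\,|V(S)|\le K}|c^{G'}_S-c^{H'}_S|<\delta$, where $S$ runs over the isomorphism classes of connected graphs with at most $K$ vertices.
   Context: Fix an integer $d\ge 1$. $\mathbf{G}_d$ is the set of finite simple graphs with all vertex degrees at most $d$ (up to isomorphism), and $V(G)$, $E(G)$ denote the vertex and edge sets of $G$. Size of a component means its number of vertices. $U^r_d$ is the finite set of rooted-isomorphism classes of rooted graphs with degrees at most $d$ in which every vertex is at shortest-path distance at most $r$ from the root. For $G\in\mathbf{G}_d$, $r\ge1$, $\alpha\in U^r_d$: $p(G,\alpha)$ is the proportion of vertices $v$ of $G$ whose $r$-ball, rooted at $v$, is rooted-isomorphic to $\alpha$. Enumerating the elements of $\bigcup_{r\ge1}U^r_d$ as $\alpha_1,\alpha_2,\dots$, put $\mathcal{L}(G)=(p(G,\alpha_1),p(G,\alpha_2),\dots)\in[0,1]^{\mathbf{N}}$; fix a metric $d_\pi$ on $[0,1]^{\mathbf{N}}$ generating the product topology and set $d_{stat}(G,H)=d_\pi(\mathcal{L}(G),\mathcal{L}(H))$.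 $\mathcal{P}\subset\mathbf{G}_d$ is a hyperfinite family if for every $\epsilon>0$ there is $K>0$ such that for each $G\in\mathcal{P}$ there is $Z\subset V(G)$ with $|Z|<\epsilon|V(G)|$ such that after removing all edges incident to $Z$ every component of the remaining graph has size at most $K$. For a finite graph $G'$ and a connected graph $S$, $C^{G'}_S$ is the set of vertices of $G'$ lying in a component of $G'$ isomorphic to $S$, and $c^{G'}_S=|C^{G'}_S|/|V(G')|$.
   Formalization: The bounds 2ε|E(G)| and 2ε|E(H)| on removed edges are replaced by 2ε·max(|E|,|V|/2) for each graph, since the printed bound fails for edgeless or very sparse graphs (e.g. G=H=K_1); it is unchanged whenever |V|≤2|E|. *)

(* Defs.v *)
From HB Require Import structures.
From mathcomp Require Import all_boot all_order all_algebra.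
From mathcomp Require Import boolp classical_sets reals topology normedtype.

Set Implicit Arguments.
Unset Strict Implicit.
Unset Printing Implicit Defensive.

Import Order.TTheory GRing.Theory Num.Theory.
Import numFieldNormedType.Exports.

Local Open Scope ring_scope.

Record sgraph := SGraph {
  vertex :> finType;
  adj : rel vertex;
  adj_sym : symmetric adj;
  adj_irr : irreflexive adj }.

(* An edge is the two-element set of its end points. *)
Definition edges (G : sgraph) : {set {set G}} :=
  [set [set p.1; p.2] | p : G * G & adj p.1 p.2].

Section GraphOn.
Variables (V : finType) (E : {set {set V}}).

Definition set_adj : rel V := fun x y => (x != y) && ([set x; y]%SET \in E).

Lemma set_adj_sym : symmetric set_adj.
Proof. by move=> x y; rewrite /set_adj eq_sym finset.setUC. Qed.

Lemma set_adj_irr : irreflexive set_adj.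
Proof. by move=> x; rewrite /set_adj eqxx. Qed.

(* Members of E that do not have exactly two elements are ignored. *)
Definition graph_on : sgraph := SGraph set_adj_sym set_adj_irr.

End GraphOn.

Definition del_edges (G : sgraph) (F : {set {set G}}) : sgraph :=
  graph_on (edges G :\: F).

Section Induced.
Variables (G : sgraph) (A : {set G}).

Definition ind_adj : rel {x : G | x \in A} := fun x y => adj (val x) (val y).

Lemma ind_adj_sym : symmetric ind_adj.
Proof. by move=> x y; apply: adj_sym. Qed.

Lemma ind_adj_irr : irreflexive ind_adj.
Proof. by move=> x; apply: adj_irr. Qed.

Definition induced : sgraph := SGraph ind_adj_sym ind_adj_irr.

End Induced.

Definition is_iso (G H : sgraph) (f : G -> H) : Prop :=
  bijective f /\ forall x y, adj (f x) (f y) = adj x y.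

Definition graph_iso (G H : sgraph) : Prop := exists f : G -> H, is_iso f.

Definition max_degree_le (d : nat) (G : sgraph) : Prop :=
  forall x : G, (#|[set y | adj x y]| <= d)%N.

Definition component (G : sgraph) (x : G) : {set G} :=
  [set y | connect (@adj G) x y].

Definition components_le (K : nat) (G : sgraph) : Prop :=
  forall x : G, (#|component x| <= K)%N.

(* The graph without vertices is not connected. *)
Definition connected_graph (G : sgraph) : bool :=
  (0 < #|G|)%N && [forall x : G, forall y : G, connect (@adj G) x y].

Definition hyperfinite (R : realType) (P : sgraph -> Prop) : Prop :=
  forall eps : R, 0 < eps -> exists K : nat, (0 < K)%N /\
    forall G : sgraph, P G -> exists Z : {set G},
      #|Z|%:R < eps * #|G|%:R /\
      components_le K (del_edges [set e in edges G | ~~ [disjoint e & Z]]).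

Record rooted_graph := RootedGraph {
  rooted_sgraph :> sgraph;
  root_of : rooted_sgraph }.

Definition rooted_iso (A B : rooted_graph) : Prop :=
  exists f : A -> B, is_iso f /\ f (root_of A) = root_of B.

Section Ball.
Variables (G : sgraph) (r : nat) (x : G).

Definition ball_set : {set G} :=
  [set y | `[< exists p : seq G,
                 [/\ path (@adj G) x p, last x p = y & (size p <= r)%N] >]].

Lemma ball_set_center : x \in ball_set.
Proof. by rewrite inE; apply/asboolP; exists [::]. Qed.

Definition rball : rooted_graph :=
  @RootedGraph (induced ball_set) (exist _ x ball_set_center).

End Ball.

(* Representatives of the members of U^r_d. *)
Definition in_U (d r : nat) (A : rooted_graph) : Prop :=
  max_degree_le d A /\ forall y : A, y \in ball_set r (root_of A).

(* Equal to 0 on the graph without vertices. *)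
Definition ball_freq (R : realType) (G : sgraph) (r : nat) (A : rooted_graph) :
  R :=
  #|[set v : G | `[< rooted_iso (rball r v) A >]]|%:R / #|G|%:R.

(* The union of the U^r_d is taken to be disjoint, as p(G, A) depends on the
   radius r for which A is regarded as a member of U^r_d; the members of the
   union are thus listed as pairs (r, A). *)
Definition enumerates_U (d : nat) (alpha : nat -> nat * rooted_graph) : Prop :=
  (forall i, (1 <= (alpha i).1)%N /\ in_U d (alpha i).1 (alpha i).2) /\
  (forall r A, (1 <= r)%N -> in_U d r A ->
     exists! i, (alpha i).1 = r /\ rooted_iso A (alpha i).2).

Definition profile (R : realType) (alpha : nat -> nat * rooted_graph)
    (G : sgraph) :
  nat -> R := fun i => ball_freq R G (alpha i).1 (alpha i).2.

Definition cube (R : realType) : set {ptws nat -> R} :=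
  fun x => forall i, 0 <= x i <= 1.

(* dpi is a metric on the cube whose open balls give, at each point of the
   cube, the neighbourhoods of the topology induced by the product topology;
   its values outside the cube are irrelevant. *)
Definition product_metric_on_cube (R : realType)
    (dpi : (nat -> R) -> (nat -> R) -> R) : Prop :=
  [/\ forall x y, cube x -> cube y -> 0 <= dpi x y,
      forall x y, cube x -> cube y -> (dpi x y = 0 <-> x = y),
      forall x y, cube x -> cube y -> dpi x y = dpi y x,
      forall x y z, cube x -> cube y -> cube z ->
        dpi x z <= dpi x y + dpi y z &
      forall (x : {ptws nat -> R}) (A : set {ptws nat -> R}), cube x ->
        (within (@cube R) (nbhs x) A <->
         exists2 e : R, 0 < e & forall y, cube y -> dpi x y < e -> A y)].

Definition d_stat (R : realType) (alpha : nat -> nat * rooted_graph)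
    (dpi : (nat -> R) -> (nat -> R) -> R) (G H : sgraph) : R :=
  dpi (profile R alpha G) (profile R alpha H).

Definition comp_freq (R : realType) (G S : sgraph) : R :=
  #|[set v : G | `[< graph_iso (induced (component v)) S >]]|%:R / #|G|%:R.

Definition conn_on (n : nat) : {set {set {set 'I_n}}} :=
  [set E | connected_graph (graph_on E)].

(* One edge set for each isomorphism class of connected graphs on n vertices. *)
Definition conn_reps (n : nat) : {set {set {set 'I_n}}} :=
  transversal
    (equivalence_partition
       (fun E F : {set {set 'I_n}} => `[< graph_iso (graph_on E) (graph_on F) >])
       (conn_on n))
    (conn_on n).

Definition comp_dist (R : realType) (K : nat) (G H : sgraph) : R :=
  \sum_(n < K.+1) \sum_(E in conn_reps n)
    `|comp_freq R G (graph_on E) - comp_freq R H (graph_on E)|.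

(* This is |E(G)| as soon as |V(G)| <= 2|E(G)|, in particular when G has no
   isolated vertex.  In a sparser graph, removing few edges relative to
   |E(G)| may not be enough to make the components bounded: take an expander
   on n vertices together with n^2 isolated vertices, or no edge at all. *)
Definition edge_budget (R : realType) (G : sgraph) : R :=
  Num.max #|edges G|%:R (#|G|%:R / 2).

(* Main.v *)
(* Suppose that a graph Y is cut into small pieces at the price of few edges, and
   that X and Y have nearly the same ball statistics. For each piece of Y choose
   a uniform vertex u of the piece and a uniform embedding of the r-ball of u in
   X, and pull back to the piece whatever structure X carries. The law of the
   pulled back structure at a point x would be right if it were conditioned on
   the ball of x rather than on the ball of u; by an L^2 increment argument the
   difference is negligible for one of boundedly many radii r.

   Pulling back a vertex set shows that a graph H close to a hyperfinite G is
   hyperfinite with the same constants: otherwise the greedy removal of sets with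
   small boundary stops at a large set U all of whose small subsets have large
   boundary in U, and a copy of U in G contradicts the partition of G. Hence both
   G and H have cheap partitions into classes of size at most K, and also much
   finer ones. Take the smaller of the two graphs with its partition into classes
   of size at most K and pull it back to the larger one along the finer pieces. A
   variance bound gives a choice whose class statistics are close to their
   expectation once the larger graph has many vertices. If both graphs are small,
   the frequencies of whole components nearly agree, and isomorphic components are
   partitioned in the same way. *)
Require Import Defs.
From mathcomp Require Import all_boot all_order all_algebra.
From mathcomp Require Import boolp classical_sets reals topology normedtype.
From mathcomp Require Import fintype finset ring lra zify.
Import Order.TTheory GRing.Theory Num.Theory.
Import numFieldNormedType.Exports.
Set Implicit Arguments.
Unset Strict Implicit.
Unset Printing Implicit Defensive.
Local Open Scope ring_scope.

(** * Balls and local isomorphisms *)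

(** The obstacle: for a uniform embedding [g] of a ball of [u], the law of [g x] may depend on more
    than the ball of [x]. It is enclosed between two radii. An embedding of the [r + K]-ball of [u]
    preserves the [r]-ball of every [x] in the piece; and composition with local isomorphisms shows
    that the law of [g x] is constant on each type of radius [r + K + K]. So the mean of [f (g x)]
    is a mean of the conditional expectation of [f] at the larger radius, while the one at radius
    [r] is determined by [x] alone. Their difference is a martingale increment, whence the gain from
    orthogonality. [K] may depend on [eps] only, while [delta] asks for arbitrarily precise
    frequencies. The precision is paid for by the finer pieces, of size at most [K2]: few edges are
    cut between them, and a class of size at most [K] that is far enough from the cuts is copied
    exactly. So the bound [K] and the edge cost survive up to an error chosen after [K]. *)

Section Balls.
Variable G : sgraph.
Implicit Types (x y z u : G) (r k : nat).

Lemma ballP r x y : reflect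
  (exists p : seq G, [/\ path (@adj G) x p, last x p = y & (size p <= r)%N])
  (y \in ball_set r x).
Proof. by rewrite inE; apply: (iffP (asboolP _)). Qed.

Lemma ball_refl r x : x \in ball_set r x.
Proof. exact: ball_set_center. Qed.

Lemma ball_sub r k x : (r <= k)%N -> ball_set r x \subset ball_set k x.
Proof.
move=> le_rk; apply/subsetP => y /ballP[p [xp lp sp]]; apply/ballP.
by exists p; split=> //; apply: leq_trans sp le_rk.
Qed.

Lemma ball_trans r k x y z :
  y \in ball_set r x -> z \in ball_set k y -> z \in ball_set (r + k) x.
Proof.
move=> /ballP[p [xp <- sp]] /ballP[q [pq <- sq]]; apply/ballP.
by exists (p ++ q); rewrite cat_path xp pq last_cat size_cat leq_add.
Qed.

Lemma ball_adj x y : adj x y -> y \in ball_set 1 x.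
Proof. by move=> xy; apply/ballP; exists [:: y]; rewrite /= xy. Qed.

Lemma ballS_adj r x y z :
  y \in ball_set r x -> adj y z -> z \in ball_set r.+1 x.
Proof. by move=> xy /ball_adj yz; rewrite -addn1; apply: ball_trans yz. Qed.

Lemma ball0 x : ball_set 0 x = [set x]%SET.
Proof.
apply/setP=> y; rewrite !inE; apply/asboolP/eqP => [[p [_ <- ]]|->].
  by rewrite leqn0 => /nilP ->.
by exists [::].
Qed.

Lemma ballSP r x y : y \in ball_set r.+1 x ->
  y \in ball_set r x \/ exists2 z, z \in ball_set r x & adj z y.
Proof.
move=> /ballP[p]; case/lastP: p => [|p z] [].
  by move=> _ <- _; left; apply: ball_refl.
rewrite rcons_path last_rcons size_rcons => /andP[xp pz] <- sp; right.
by exists (last x p) => //; apply/ballP; exists p.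
Qed.

Lemma ball_sym r x y : (y \in ball_set r x) = (x \in ball_set r y).
Proof.
have H (a b : G) : a \in ball_set r b -> b \in ball_set r a; last first.
  by apply/idP/idP; apply: H.
move=> /ballP[p [bp <- sp]]; apply/ballP; exists (rev (belast b p)); split.
- by rewrite rev_path; under eq_path do rewrite adj_sym.
- by case: p {bp sp} => //= c p; rewrite rev_cons last_rcons.
- by rewrite size_rev size_belast.
Qed.

Lemma card_ball d r x : max_degree_le d G -> (#|ball_set r x| <= d.+1 ^ r)%N.
Proof.
move=> dG; elim: r => [|r IH]; first by rewrite ball0 cards1.
have sub : ball_set r.+1 x \subset
    \bigcup_(z in ball_set r x) (z |: [set y | adj z y])%SET.
  apply/subsetP => y /ballSP[xy|[z xz zy]]; apply/bigcupP.
    by exists y; rewrite ?setU11.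
  by exists z; rewrite // !inE zy orbT.
apply: leq_trans (subset_leq_card sub) _.
apply: (@leq_trans (\sum_(z in ball_set r x) d.+1)).
  elim/big_rec2: _ => [|z n A _ leA]; first by rewrite cards0.
  apply: leq_trans (leq_card_setU _ _) (leq_add _ leA).
  by rewrite cardsU1 -add1n leq_add ?leq_b1.
by rewrite sum_nat_const expnSr leq_mul2r IH orbT.
Qed.

(** A path shortened to distinct vertices stays in a class of at most [k] vertices, so it has fewer
    than [k] edges: bounds on class sizes become radii. *)
Lemma connect_ball (k : nat) x y (a : rel G) : subrel a (@adj G) ->
  (#|[set z | connect a x z]| <= k)%N -> connect a x y -> y \in ball_set k x.
Proof.
move=> sub le_k /connectP[p xp ->]; case: (shortenP xp) => q xq uq _.
apply/ballP; exists q; split=> //; first exact: sub_path xq.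
apply: leq_trans le_k; apply: leq_trans (_ : (size (x :: q) <= _)%N) => //.
rewrite -(card_uniqP uq); apply/subset_leq_card/subsetP => z.
by rewrite inE => zq; apply: (path_connect xq).
Qed.

End Balls.

Section LocalIso.

(* g restricts to an isomorphism of the r-ball of u onto the r-ball of g u; its
   values outside the ball are arbitrary. *)
Definition liso (Y X : sgraph) (r : nat) (u : Y) (g : Y -> X) : bool :=
  [&& [forall x in ball_set r u, forall y in ball_set r u,
         (g x == g y) ==> (x == y)],
      [forall x in ball_set r u, forall y in ball_set r u,
         adj (g x) (g y) == adj x y] &
      g @: ball_set r u == ball_set r (g u)].

Lemma lisoP (Y X : sgraph) (r : nat) (u : Y) (g : Y -> X) :
  reflect [/\ {in ball_set r u &, injective g},
              {in ball_set r u &, forall x y, adj (g x) (g y) = adj x y} &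
              g @: ball_set r u = ball_set r (g u)]
          (liso r u g).
Proof.
apply: (iffP and3P) => -[gi ga gb]; split.
- by move=> x y xB yB /eqP gxy; have /eqP := implyP (forall_inP (forall_inP gi x xB) y yB) gxy.
- by move=> x y xB yB; apply/eqP; apply: (forall_inP (forall_inP ga x xB) y yB).
- exact/eqP.
- apply/forall_inP => x xB; apply/forall_inP => y yB; apply/implyP => /eqP gxy.
  by apply/eqP/gi.
- by apply/forall_inP => x xB; apply/forall_inP => y yB; apply/eqP/ga.
- exact/eqP.
Qed.

Lemma eq_liso (Y X : sgraph) r (u : Y) (g h : Y -> X) :
  {in ball_set r u, g =1 h} -> liso r u g -> liso r u h.
Proof.
move=> gh /lisoP[gi ga gb]; apply/lisoP; split.
- by move=> x y xB yB; rewrite -!gh //; apply: gi.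
- by move=> x y xB yB; rewrite -!gh //; apply: ga.
- by rewrite -(eq_in_imset gh) gb gh // ball_refl.
Qed.

Section Restrict.
Variables (Y X : sgraph) (R : nat) (u : Y) (g : Y -> X).
Hypothesis gP : liso R u g.

(** Paths are carried forward by induction on their length. Conversely a path from [g x] is lifted
    edge by edge: it stays in the [R]-ball of [g u], where every vertex has a preimage. *)
Lemma liso_ball k r x : x \in ball_set k u -> (r + k <= R)%N ->
  g @: ball_set r x = ball_set r (g x).
Proof.
move=> xk; have /lisoP[_ ga gb] := gP.
have inB s y : (s + k <= R)%N -> y \in ball_set s x -> y \in ball_set R u.
  move=> sk xy; apply: (subsetP (ball_sub _ sk)).
  by rewrite addnC; apply: ball_trans xy.
have fwd s y : (s + k <= R)%N -> y \in ball_set s x -> g y \in ball_set s (g x).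
  elim: s y => [|s IH] y sk; first by rewrite !ball0 !inE => /eqP ->.
  move=> xy; case: (ballSP xy) => [xy'|[z xz zy]].
    apply: (subsetP (ball_sub _ (leqnSn s))).
    by apply: IH => //; apply: ltnW.
  apply: (ballS_adj (y := g z)); first by apply: IH => //; apply: ltnW.
  by rewrite ga //; [apply: inB xz; apply: ltnW | apply: inB xy].
elim: r => [|r IH] rk.
  by rewrite !ball0 imset_set1.
apply/setP => y; apply/imsetP/idP => [[z xz ->]|xy]; first exact: fwd.
have kR : (k <= R)%N by lia.
have gxB : g x \in ball_set k (g u).
  have kk : (k + 0 <= R)%N by lia.
  have: g @: ball_set k u \subset ball_set k (g u).
    apply/subsetP => _ /imsetP[z zk ->].
    elim: k z zk kR {xk inB fwd IH rk kk} => [|k IH] z zk kR.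
      by move: zk; rewrite !ball0 !inE => /eqP ->.
    case: (ballSP zk) => [zk'|[w wk wz]].
      apply: (subsetP (ball_sub _ (leqnSn k))).
      by apply: IH => //; apply: ltnW.
    apply: (ballS_adj (y := g w)); first by apply: IH => //; apply: ltnW.
    rewrite ga //.
      exact: (subsetP (ball_sub u (ltnW kR))) wk.
    exact: (subsetP (ball_sub u kR)) zk.
  by move/subsetP; apply; apply: imset_f.
have yB : y \in ball_set R (g u).
  apply: (subsetP (ball_sub _ rk)); rewrite addnC.
  exact: ball_trans xy.
move: yB; rewrite -gb => /imsetP[w wB yE].
case: (ballSP xy) => [|[z']].
  rewrite -IH; last by lia.
  move=> /imsetP[w' xw' yE']; exists w' => //.
  exact: (subsetP (ball_sub _ (leqnSn r))).
rewrite -IH; last by lia.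
move=> /imsetP[z xz ->]; rewrite yE ga //; last by apply: inB xz; lia.
by move=> zw; exists w => //; apply: ballS_adj zw.
Qed.

Lemma liso_restrict k r x :
  x \in ball_set k u -> (r + k <= R)%N -> liso r x g.
Proof.
move=> xk rk; have /lisoP[gi ga gb] := gP.
have inB y : y \in ball_set r x -> y \in ball_set R u.
  move=> xy; apply: (subsetP (ball_sub _ rk)).
  by rewrite addnC; apply: ball_trans xy.
apply/lisoP; split.
- by move=> y z /inB yB /inB zB; apply: gi.
- by move=> y z /inB yB /inB zB; apply: ga.
- exact: liso_ball xk rk.
Qed.

End Restrict.

Lemma liso_comp (Z Y X : sgraph) r (u : Z) (g : Z -> Y) (h : Y -> X) :
  liso r u g -> liso r (g u) h -> liso r u (h \o g).
Proof.
move=> /lisoP[gi ga gb] /lisoP[hi ha hb].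
have inB x : x \in ball_set r u -> g x \in ball_set r (g u).
  by move=> xB; rewrite -gb imset_f.
apply/lisoP; split=> [x y xB yB /=|x y xB yB /=|].
- by move/hi => E; apply: gi => //; apply: E; apply: inB.
- by rewrite ha ?ga ?inB.
- by rewrite imset_comp gb hb.
Qed.

End LocalIso.

Lemma graph_iso_sym (A B : sgraph) : graph_iso A B -> graph_iso B A.
Proof.
case=> f [[h fK hK] fa]; exists h; split; first by exists f.
by move=> x y; rewrite -fa !hK.
Qed.

Lemma graph_iso_trans (A B C : sgraph) :
  graph_iso A B -> graph_iso B C -> graph_iso A C.
Proof.
move=> [f [bf fa]] [h [bh ha]]; exists (h \o f); split; first exact: bij_comp.
by move=> x y /=; rewrite ha fa.
Qed.

Lemma rooted_iso_sym (A B : rooted_graph) : rooted_iso A B -> rooted_iso B A.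
Proof.
case=> f [[[h fK hK] fa] fr]; exists h; split; last by rewrite -fr fK.
by split; [exists f | move=> x y; rewrite -fa !hK].
Qed.

Lemma rooted_iso_trans (A B C : rooted_graph) :
  rooted_iso A B -> rooted_iso B C -> rooted_iso A C.
Proof.
move=> [f [[bf fa] fr]] [h [[bh ha] hr]]; exists (h \o f).
split; last by rewrite /= fr hr.
by split; [exact: bij_comp | move=> x y /=; rewrite ha fa].
Qed.

(** Isomorphisms between dependent subgraphs are traded for total functions on [Y], which can be
    restricted, composed and counted. *)
Lemma rooted_iso_ballP (Y X : sgraph) r (u : Y) (v : X) :
  rooted_iso (rball r u) (rball r v) <->
  exists2 g : Y -> X, liso r u g & g u = v.
Proof.
split=> [[f [[[h fK hK] fa] fr]]|[g gP <-]].
  pose g x := oapp (fun z => val (f z)) v (insub x).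
  have gE x (xB : x \in ball_set r u) : g x = val (f (Sub x xB)).
    by rewrite /g insubT.
  have gu : g u = v.
    rewrite (gE _ (ball_refl r u)); apply: etrans (congr1 val fr).
    by congr (val (f _)); apply: val_inj.
  exists g => //; apply/lisoP; split.
  - move=> x y xB yB; rewrite !gE => /val_inj/(can_inj fK).
    by move/(congr1 val).
  - by move=> x y xB yB; rewrite !gE; apply: fa.
  - rewrite gu; apply/setP => y; apply/imsetP/idP => [[x xB ->]|yB].
      by rewrite gE; apply: valP.
    exists (val (h (Sub y yB))); first exact: valP.
    rewrite (gE _ (valP _)) -[y in LHS](SubK {x | x \in ball_set r v} yB).
    congr val; rewrite -[LHS]hK; congr f; exact: val_inj.
have /lisoP[gi ga gb] := gP.
have gB x : x \in ball_set r u -> g x \in ball_set r (g u).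
  by move=> xB; rewrite -gb imset_f.
exists (fun x : rball r u => Sub (g (val x)) (gB _ (valP x)) : rball r (g u)).
split; last exact: val_inj.
split=> [|x y /=]; last by rewrite /ind_adj /= ga ?valP //; apply: valP.
apply: inj_card_bij => [x y /(congr1 val) /= gxy|].
  by apply/val_inj/gi => //; apply: valP.
rewrite !card_sig (_ : #|_| = #|g @: ball_set r u|); last first.
  by apply: eq_card => x; rewrite gb !inE.
apply: leq_trans (leq_imset_card _ _) _.
by rewrite subset_leq_card //; apply/subsetP => x; rewrite !inE.
Qed.

(** * Ball types and statistical distance *)

Section EdgeSets.
Variable V : finType.

Lemma set2_eq (a b c d : V) : ([set a; b] == [set c; d])%SET =
  (a == c) && (b == d) || (a == d) && (b == c).
Proof.
apply/eqP/orP => [E|[/andP[/eqP-> /eqP->]|/andP[/eqP-> /eqP->]]] //.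
  have : a \in [set c; d]%SET by rewrite -E set21.
  have : b \in [set c; d]%SET by rewrite -E set22.
  have : c \in [set a; b]%SET by rewrite E set21.
  have : d \in [set a; b]%SET by rewrite E set22.
  rewrite !inE ![c == _]eq_sym ![d == _]eq_sym.
  by move=> /orP[]/eqP? /orP[]/eqP? /orP[]/eqP? /orP[]/eqP?; subst;
    rewrite ?eqxx ?orbT; auto.
exact: setUC.
Qed.

Lemma set_adj_imset (e : rel V) (x y : V) : symmetric e -> irreflexive e ->
  set_adj [set [set p.1; p.2] | p : V * V & e p.1 p.2]%SET x y = e x y.
Proof.
move=> es ei; rewrite /set_adj; apply/andP/idP => [[xy /imsetP[[a b]]]|xy].
  rewrite inE /= => ab /eqP; rewrite set2_eq.
  by move=> /orP[]/andP[/eqP-> /eqP->] //; rewrite es.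
split; first by apply: contraTneq xy => ->; rewrite ei.
by apply/imsetP; exists (x, y); rewrite ?inE.
Qed.

End EdgeSets.

Lemma graph_on_copy (A : sgraph) :
  exists E : {set {set 'I_#|A|}}, @is_iso A (graph_on E) enum_rank.
Proof.
pose e (i j : 'I_#|A|) := adj (enum_val i) (enum_val j).
exists [set [set p.1; p.2] | p : 'I_#|A| * 'I_#|A| & e p.1 p.2]%SET; split.
  exact: enum_rank_bij.
move=> x y /=; rewrite set_adj_imset; first by rewrite /e !enum_rankK.
  by move=> i j; apply: adj_sym.
by move=> i; apply: adj_irr.
Qed.

Lemma max_degree_induced (d : nat) (G : sgraph) (B : {set G}) :
  max_degree_le d G -> max_degree_le d (induced B).
Proof.
move=> dG x; apply: leq_trans (dG (val x)).
rewrite -(card_imset _ val_inj); apply/subset_leq_card/subsetP => z.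
by move=> /imsetP[y xy ->]; rewrite inE in xy; rewrite inE.
Qed.

Lemma in_U_rball (d r : nat) (G : sgraph) (u : G) :
  max_degree_le d G -> in_U d r (rball r u).
Proof.
move=> dG; split; first exact: max_degree_induced.
suff lift s (y : G) (yB : y \in ball_set r u) : (s <= r)%N ->
    y \in ball_set s u -> (Sub y yB : rball r u) \in ball_set s (root_of (rball r u)).
  by move=> [y yB]; apply: lift.
elim: s y yB => [|s IH] y yB sr.
  by rewrite !ball0 !inE => /eqP E; apply/eqP/val_inj.
move=> /ballSP[ys|[z zs zy]].
  by apply: (subsetP (ball_sub _ (leqnSn s))); apply: IH ys; apply: ltnW.
have zB : z \in ball_set r u by apply: (subsetP (ball_sub u (ltnW sr))) zs.
by apply: (ballS_adj (IH z zB (ltnW sr) zs)).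
Qed.

Section BallType.
Variables (d : nat) (alpha : nat -> nat * rooted_graph).
Hypothesis halpha : enumerates_U d alpha.

(** Types are indices into [alpha], so that vertices of different graphs can be compared. The
    default 0 is not reached when [r] is positive and the degrees are at most [d]. *)
Definition btype (r : nat) (G : sgraph) (u : G) : nat :=
  if pselect (exists i, (alpha i).1 = r /\ rooted_iso (rball r u) (alpha i).2)
    is left h then projT1 (cid h) else 0%N.

Lemma btypeP r (G : sgraph) (u : G) : (0 < r)%N -> max_degree_le d G ->
  (alpha (btype r u)).1 = r /\ rooted_iso (rball r u) (alpha (btype r u)).2.
Proof.
move=> r0 dG; rewrite /btype; case: pselect => [h|[]]; first exact: projT2 (cid h).
by have [i [? _]] := halpha.2 r _ r0 (in_U_rball r u dG); exists i.
Qed.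

Lemma btype_uniq r (G : sgraph) (u : G) i : (0 < r)%N -> max_degree_le d G ->
  (alpha i).1 = r -> rooted_iso (rball r u) (alpha i).2 -> btype r u = i.
Proof.
move=> r0 dG ir ui; have [j [_ uj]] := halpha.2 r _ r0 (in_U_rball r u dG).
by rewrite -(uj (btype r u)) ?(uj i) //; apply: btypeP.
Qed.

Lemma btype_eqP r (G H : sgraph) (u : G) (v : H) : (0 < r)%N ->
  max_degree_le d G -> max_degree_le d H ->
  btype r u = btype r v <-> exists2 g : G -> H, liso r u g & g u = v.
Proof.
move=> r0 dG dH; rewrite -rooted_iso_ballP; split=> [E|uv].
  have [_ iu] := btypeP u r0 dG; have [_ iv] := btypeP v r0 dH.
  by apply: rooted_iso_trans iu _; rewrite E; apply: rooted_iso_sym.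
have [rv iv] := btypeP v r0 dH; apply: btype_uniq => //.
exact: rooted_iso_trans iv.
Qed.

(** A ball has at most [d.+1 ^ r] vertices, hence a copy on some ['I_n] with [n] below a fixed
    bound; [N] exceeds the indices of these finitely many codes. *)
Lemma btype_bounded r : (0 < r)%N ->
  exists N, forall (G : sgraph) (u : G), max_degree_le d G -> (btype r u < N)%N.
Proof.
move=> r0; pose M := (d.+1 ^ r)%N.
pose code := {n : 'I_M.+1 & ({set {set 'I_n}} * 'I_n)%type}.
pose graph (c : code) : rooted_graph :=
  RootedGraph (rooted_sgraph := graph_on (tagged c).1) (tagged c).2.
pose idx c := if pselect (exists i, (alpha i).1 = r /\ rooted_iso (graph c) (alpha i).2)
    is left h then projT1 (cid h) else 0%N.
exists (\max_c idx c).+1 => G u dG; rewrite ltnS.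
suff [c cu] : exists c : code, rooted_iso (rball r u) (graph c).
  rewrite (_ : btype r u = idx c); first exact: leq_bigmax.
  have [ru iu] := btypeP u r0 dG.
  rewrite /idx; case: pselect => [h|[]]; last first.
    exists (btype r u); split=> //.
    by apply: rooted_iso_trans (rooted_iso_sym cu) iu.
  case: (cid h) => i [/= ri ci]; apply: btype_uniq => //.
  exact: rooted_iso_trans ci.
have [E [bE aE]] := graph_on_copy (rball r u).
have le_M : (#|rball r u| < M.+1)%N.
  rewrite ltnS card_sig; apply: leq_trans (card_ball r u dG).
  by apply/subset_leq_card/subsetP.
exists (Tagged (fun n : 'I_M.+1 => ({set {set 'I_n}} * 'I_n)%type)
  (i := Ordinal le_M) (E, enum_rank (root_of (rball r u)))).
by exists enum_rank; split.
Qed.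

Variable N : nat -> nat.
Hypothesis btype_lt : forall r (G : sgraph) (u : G), (0 < r)%N ->
  max_degree_le d G -> (btype r u < N r)%N.

Definition tfreq (R : realType) r i (G : sgraph) : R :=
  #|[set v : G | btype r v == i]|%:R / #|G|%:R.

(** The L^1 distance between the laws of the ball types; after [d_stat_close] this is the only form
    in which closeness is used. *)
Definition close_stat (R : realType) (beta : R) (rmax : nat) (G H : sgraph) :=
  forall r, (0 < r <= rmax)%N ->
    \sum_(i < N r) `|tfreq R r i G - tfreq R r i H| <= beta.

Lemma close_stat_refl (R : realType) (beta : R) rmax (G : sgraph) :
  0 <= beta -> close_stat beta rmax G G.
Proof. by move=> b0 r _; rewrite big1 // => i _; rewrite subrr normr0. Qed.

Lemma close_stat_sym (R : realType) (beta : R) rmax (G H : sgraph) :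
  close_stat beta rmax G H -> close_stat beta rmax H G.
Proof.
move=> GH r rr; apply: le_trans (GH r rr); apply: ler_sum => i _.
by rewrite distrC.
Qed.

Lemma close_stat_le (R : realType) (beta beta' : R) r r' (G H : sgraph) :
  beta <= beta' -> (r' <= r)%N ->
  close_stat beta r G H -> close_stat beta' r' G H.
Proof.
move=> bb rr GH s /andP[s0 sr]; apply: le_trans bb; apply: GH.
by rewrite s0 (leq_trans sr).
Qed.

Lemma profile_tfreq (R : realType) (G : sgraph) i : max_degree_le d G ->
  profile R alpha G i = tfreq R (alpha i).1 i G.
Proof.
move=> dG; rewrite /profile /ball_freq /tfreq; congr (_%:R / _).
have i0 := (halpha.1 i).1.
apply: eq_card => v; rewrite !inE; apply/asboolP/eqP => [iv|<-].
  exact: btype_uniq.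
have [{1}<- ] := btypeP v i0 dG.
by have [-> ] := btypeP v i0 dG.
Qed.

Lemma tfreq_other (R : realType) (G : sgraph) r i : (0 < r)%N ->
  max_degree_le d G -> (alpha i).1 != r -> tfreq R r i G = 0.
Proof.
move=> r0 dG ir; rewrite /tfreq (_ : [set v | _] = set0)%SET.
  by rewrite cards0 mul0r.
apply/setP => v; rewrite !inE; apply: contraNF ir => /eqP <-.
by apply/eqP; apply: (btypeP v r0 dG).1.
Qed.

Lemma profile_cube (R : realType) (G : sgraph) : @cube R (profile R alpha G).
Proof.
move=> i; rewrite /profile /ball_freq; set A := [set v | _]%SET.
rewrite divr_ge0 //=; have [->|G0] := posnP #|G|; first by rewrite invr0 mulr0.
by rewrite ler_pdivrMr ?ltr0n // mul1r ler_nat max_card.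
Qed.

(** * From the metric on the cube to ball frequencies *)

Section Metric.
Variables (R : realType) (dpi : (nat -> R) -> (nat -> R) -> R).
Hypothesis hdpi : product_metric_on_cube dpi.

Lemma cube_compact : compact (@cube R).
Proof.
have -> : @cube R = [set f : {ptws nat -> R} | forall i, `[0, 1]%classic (f i)]%classic.
  by apply/seteqP; split=> f fc i; have := fc i; rewrite /= in_itv.
exact: (@tychonoff nat (fun=> R : topologicalType) (fun=> `[0, 1]%classic)
  (fun=> @segment_compact R 0 1)).
Qed.

(** The metric is tied to the topology only point by point; compactness makes this uniform. Pairs at
    distance at most [e] with coordinates at least [eta] apart would give a filter base as [e] tends
    to 0; close to a cluster point, both members of such a pair have their coordinate within
    [eta / 2] of that of the point. *)
Lemma dpi_coord (i : nat) (eta : R) : 0 < eta -> exists2 f : R, 0 < f &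
  forall x y, cube x -> cube y -> dpi x y <= f -> `|x i - y i| < eta.
Proof.
move=> eta0; have [d0 d00 dsym dtri dtop] := hdpi.
apply: contrapT => noF.
pose B (e : R) : set {ptws nat -> R} :=
  [set x | cube x /\ exists2 y, cube y & dpi x y <= e /\ eta <= `|x i - y i|]%classic.
have B0 e : 0 < e -> (B e !=set0)%classic.
  move=> e0; apply: contrapT => Be; apply: noF; exists e => // x y cx cy xy.
  by rewrite ltNge; apply/negP => exy; apply: Be; exists x; split=> //; exists y.
pose F := filter_from [set e : R | 0 < e]%classic B.
have FF : ProperFilter F.
  apply: filter_from_proper; last by move=> e /B0.
  apply: filter_from_filter; first by exists 1; rewrite /= ltr01.
  move=> a b /= a0 b0; exists (Num.min a b); first by rewrite /= lt_min a0.
  move=> x [cx [y cy []]]; rewrite le_min => /andP[xa xb] exy.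
  by split; split=> //; exists y.
have [|p [cp clp]] := cube_compact FF.
  by exists 1; [rewrite /= ltr01 | move=> x []].
have half0 : 0 < eta / 2 by rewrite divr_gt0.
have [e e0 pe] : exists2 e : R, 0 < e &
    forall y, cube y -> dpi p y < e -> `|p i - y i| < eta / 2.
  apply/(dtop p [set y | `|p i - y i| < eta / 2]%classic cp).
  have pc : continuous (fun x : {ptws nat -> R} => x i : R).
    exact: (@proj_continuous nat (fun=> R : topologicalType) i).
  have h : nbhs p [set y : {ptws nat -> R} | ball (p i : R) (eta / 2) (y i)]%classic.
    exact: (pc p _ (nbhsx_ballx (p i : R) _ half0)).
  have fN : Filter (nbhs p) by exact: nbhs_filter.
  by apply: (@filterS _ (nbhs p) fN _ _ _ h) => y yb _.
have e20 : 0 < e / 2 by rewrite divr_gt0.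
have nbp : nbhs p [set y : {ptws nat -> R} | cube y -> dpi p y < e / 2]%classic.
  by apply/(dtop p [set y | dpi p y < e / 2]%classic cp); exists (e / 2).
have FB : F (B (e / 2)) by exists (e / 2).
have [x [[cx [y cy [xy exy]]] px]] := clp _ _ FB nbp.
have {}px : dpi p x < e / 2 := px cx.
have py : `|p i - y i| < eta / 2 by apply: pe => //; have := dtri p x y cp cx cy; lra.
have {}px : `|p i - x i| < eta / 2 by apply: pe => //; lra.
move: exy; rewrite leNgt => /negP; apply.
have -> : x i - y i = (p i - y i) - (p i - x i) by ring.
apply: le_lt_trans (ler_normB _ _) _; lra.
Qed.

Lemma d_stat_close (beta : R) rmax : 0 < beta -> exists2 f : R, 0 < f &
  forall G H : sgraph, max_degree_le d G -> max_degree_le d H ->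
  d_stat alpha dpi G H <= f -> close_stat beta rmax G H.
Proof.
move=> beta0; pose M := (\max_(r < rmax.+1) N r)%N.
have eta0 : 0 < beta / M.+1%:R by rewrite divr_gt0.
have [f f0 fP] : exists2 f : R, 0 < f & forall i x y, (i < M)%N -> cube x ->
    cube y -> dpi x y <= f -> `|x i - y i| <= beta / M.+1%:R.
  elim: {-2}M => [|m [f f0 IH]]; first by exists 1.
  have [g g0 gP] := dpi_coord m eta0.
  exists (Num.min f g); first by rewrite lt_min f0.
  move=> i x y im cx cy; rewrite le_min => /andP[xf xg].
  move: im; rewrite ltnS leq_eqVlt => /orP[/eqP->|im]; last exact: IH.
  by apply: ltW; apply: gP.
exists f => // G H dG dH GH r /andP[r0 rr].
have NM : (N r <= M)%N.
  have rr' : (r < rmax.+1)%N by [].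
  exact: (@leq_bigmax _ (fun r : 'I_rmax.+1 => N r) (Ordinal rr')).
apply: (@le_trans _ _ (\sum_(i < N r) beta / M.+1%:R)).
  (* Indices below [N r] that list a ball of another radius contribute 0. *)
  apply: ler_sum => i _; have [ir|ir] := eqVneq (alpha i).1 r; last first.
    by rewrite !tfreq_other // subrr normr0 ltW.
  have -> : tfreq R r i G = profile R alpha G i by rewrite profile_tfreq ?ir.
  have -> : tfreq R r i H = profile R alpha H i by rewrite profile_tfreq ?ir.
  by apply: fP => //; try exact: profile_cube; apply: leq_trans (ltn_ord i) NM.
rewrite sumr_const card_ord -[_ *+ _]mulr_natr mulrAC ler_pdivrMr ?ltr0n //.
by rewrite ler_pM2l // ler_nat ltnW.
Qed.

End Metric.
End BallType.

(** * Transfer of averages *)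

Section Averages.
Variable R : realType.

Section OneType.
Variables (X : finType) (t : X -> nat).
Implicit Types (f : X -> R) (i : nat).

(* The conditional expectation of f given t = i; it is 0 when t never takes the
   value i. *)
Definition cexp f i : R := (\sum_(y | t y == i) f y) / #|[pred y | t y == i]|%:R.

Lemma sum_cexp f (c : X -> R) : (forall y z, t y = t z -> c y = c z) ->
  \sum_y c y * cexp f (t y) = \sum_y c y * f y.
Proof.
move=> ct; under eq_bigr => y _ do rewrite /cexp mulrCA mulr_suml.
rewrite (exchange_big_dep xpredT) //=; apply: eq_bigr => z _.
rewrite (eq_bigr (fun=> f z * (c z / #|[pred y | t y == t z]|%:R))); last first.
  by move=> y /eqP zy; rewrite zy (ct y z).
have nE : #|[pred y | t z == t y]| = #|[pred y | t y == t z]|.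
  by apply: eq_card => y; rewrite !inE eq_sym.
rewrite sumr_const -[LHS]mulr_natr nE -mulrA divfK 1?mulrC // pnatr_eq0 -lt0n.
by apply/card_gt0P; exists z; apply: eqxx.
Qed.

Lemma cexp_le f B i : 0 <= B -> (forall y, f y <= B) -> cexp f i <= B.
Proof.
move=> B0 fB; rewrite /cexp; have [->|c0] := posnP #|[pred y | t y == i]|.
  by rewrite invr0 mulr0.
rewrite ler_pdivrMr ?ltr0n // mulr_natr -sumr_const.
by apply: ler_sum => y _.
Qed.

Lemma cexp_ge0 f i : (forall y, 0 <= f y) -> 0 <= cexp f i.
Proof. by move=> f0; rewrite divr_ge0 // sumr_ge0. Qed.

Lemma cexp_out f i : (forall y, t y != i) -> cexp f i = 0.
Proof. by move=> ti; rewrite /cexp big_pred0 ?mul0r // => y; apply/negbTE. Qed.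

Lemma sum_by_type (N : nat) (h : nat -> R) : (forall y, (t y < N)%N) ->
  \sum_y h (t y) = \sum_(i < N) #|[set y | t y == i]|%:R * h i.
Proof.
move=> tN; rewrite (partition_big (fun y => Ordinal (tN y)) xpredT) //=.
apply: eq_bigr => i _; rewrite (eq_bigr (fun=> h i)) => [|y /eqP <- //].
rewrite sumr_const mulr_natl cardsE; congr (_ *+ _).
Qed.

End OneType.

(** Pythagoras: as [t2] refines [t1], the difference of the two conditional expectations is
    orthogonal to the coarser one. *)
Lemma cexp_energy (X : finType) (t1 t2 : X -> nat) (f : X -> R) :
  (forall y z, t2 y = t2 z -> t1 y = t1 z) ->
  \sum_y (cexp t2 f (t2 y) - cexp t1 f (t1 y)) ^+ 2 =
  \sum_y cexp t2 f (t2 y) ^+ 2 - \sum_y cexp t1 f (t1 y) ^+ 2.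
Proof.
move=> t21; have E2 : \sum_y cexp t1 f (t1 y) * cexp t2 f (t2 y) =
    \sum_y cexp t1 f (t1 y) ^+ 2.
  pose c y := cexp t1 f (t1 y).
  rewrite (@sum_cexp _ t2 f c) => [|y z /t21 E]; last by rewrite /c E.
  by rewrite -(@sum_cexp _ t1 f c) => [//|y z E]; rewrite /c E.
rewrite (eq_bigr (fun y => cexp t2 f (t2 y) ^+ 2 + (cexp t1 f (t1 y) ^+ 2 -
  2 * (cexp t1 f (t1 y) * cexp t2 f (t2 y))))) => [|y _]; last by ring.
by rewrite !big_split /= sumrN -mulr_sumr E2; ring.
Qed.

Lemma small_increment (e : nat -> R) (L : nat) (B : R) : (0 < L)%N ->
  0 <= e 0%N -> e L <= B -> exists2 j, (j < L)%N & e j.+1 - e j <= B / L%:R.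
Proof.
move=> L0 e0 eL; apply: contrapT => noj.
have H j : (j < L)%N -> B / L%:R < e j.+1 - e j.
  by move=> jL; rewrite ltNge; apply/negP => ej; apply: noj; exists j.
have : \sum_(j < L) (B / L%:R) < \sum_(j < L) (e j.+1 - e j).
  apply: ltr_sum; last by move=> i _; apply: H.
  by apply/hasP; exists (Ordinal L0); rewrite // mem_index_enum.
rewrite sumr_const card_ord -(mulr_natr (B / _)) divfK ?pnatr_eq0 -?lt0n //.
rewrite -(big_mkord xpredT (fun j => e j.+1 - e j)) telescope_sumr //.
by lra.
Qed.

(** Cauchy-Schwarz without square roots, through [|D| <= D^2 / (2 kappa) + kappa / 2]. *)
Lemma sum_norm_le (X : finType) (D : X -> R) (kappa : R) : 0 < kappa ->
  \sum_y D y ^+ 2 <= #|X|%:R * kappa ^+ 2 -> \sum_y `|D y| <= #|X|%:R * kappa.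
Proof.
move=> k0 D2.
have H y : `|D y| <= D y ^+ 2 / (2 * kappa) + kappa / 2.
  rewrite -real_normK ?num_real //; set z := `|D y|.
  rewrite -subr_ge0 (_ : _ - _ = (z - kappa) ^+ 2 / (2 * kappa)).
    by rewrite divr_ge0 ?sqr_ge0 ?mulr_ge0 // ltW.
  by field; rewrite gt_eqF.
apply: le_trans (ler_sum _ (fun y _ => H y)) _.
rewrite big_split /= -mulr_suml sumr_const -(mulr_natl (kappa / 2)).
have : (\sum_y D y ^+ 2) / (2 * kappa) <= #|X|%:R * kappa ^+ 2 / (2 * kappa).
  by rewrite ler_pM2r // invr_gt0 mulr_gt0.
rewrite (_ : #|X|%:R * kappa ^+ 2 / (2 * kappa) = #|X|%:R * (kappa / 2)).
  by lra.
by field; rewrite gt_eqF.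
Qed.

End Averages.

(** * Random local embeddings and the martingale argument *)

Section Transfer.
Variables (R : realType) (d : nat) (alpha : nat -> nat * rooted_graph).
Hypothesis halpha : enumerates_U d alpha.
Variable N : nat -> nat.
Hypothesis btype_lt : forall r (G : sgraph) (u : G), (0 < r)%N ->
  max_degree_le d G -> (btype alpha r u < N r)%N.

Local Notation bt := (btype alpha).

Lemma btype_refine r k (G H : sgraph) (u : G) (v : H) : (0 < r)%N -> (r <= k)%N ->
  max_degree_le d G -> max_degree_le d H ->
  bt k u = bt k v -> bt r u = bt r v.
Proof.
move=> r0 rk dG dH /(btype_eqP halpha u v (leq_trans r0 rk) dG dH)[g gP gu].
apply/(btype_eqP halpha) => //; exists g => //.
by apply: (liso_restrict gP (ball_refl 0 u)); rewrite addn0.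
Qed.

Section Stats.
Variables (X Y : sgraph).
Hypotheses (dX : max_degree_le d X) (dY : max_degree_le d Y).
Hypotheses (X0 : (0 < #|X|)%N) (Y0 : (0 < #|Y|)%N).

Lemma mean_type_close (beta : R) rmax r (h : nat -> R) (B : R) :
  close_stat alpha N beta rmax Y X -> (0 < r <= rmax)%N -> 0 <= B ->
  (forall i, `|h i| <= B) ->
  `|(\sum_(x : Y) h (bt r x)) / #|Y|%:R - (\sum_(y : X) h (bt r y)) / #|X|%:R|
    <= beta * B.
Proof.
move=> cl rr B0 hB; have /andP[r0 _] := rr.
rewrite !(sum_by_type (N := N r)); try by move=> ?; apply: btype_lt.
rewrite !mulr_suml -sumrB; apply: le_trans (ler_norm_sum _ _ _) _.
apply: le_trans (ler_wpM2r B0 (cl r rr)); rewrite mulr_suml.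
apply: ler_sum => i _; rewrite ![_ * h i / _]mulrAC -mulrBl normrM.
by apply: ler_wpM2l (hB i).
Qed.

(** The conditional expectation computed in [X] is a function of the type alone, so it can be
    evaluated at vertices of [Y]; over [X] its mean is that of [f]. *)
Lemma mean_cexp_close (beta : R) rmax r (f : X -> R) (B : R) :
  close_stat alpha N beta rmax Y X -> (0 < r <= rmax)%N -> 0 <= B ->
  (forall y, 0 <= f y <= B) ->
  `|(\sum_(x : Y) cexp (@bt r X) f (bt r x)) / #|Y|%:R - (\sum_y f y) / #|X|%:R|
    <= beta * B.
Proof.
move=> cl rr B0 fB.
have -> : \sum_y f y = \sum_(y : X) cexp (@bt r X) f (bt r y).
  have := @sum_cexp R X (@bt r X) f (fun=> 1) (fun _ _ _ => erefl).
  by under eq_bigr do rewrite mul1r; under [in RHS]eq_bigr do rewrite mul1r.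
apply: (mean_type_close cl rr B0) => i.
rewrite ger0_norm ?cexp_le ?cexp_ge0 // => y; by case/andP: (fB y).
Qed.

Definition Emb r (u : Y) : {set {ffun Y -> X}} := [set g : {ffun Y -> X} | liso r u g]%SET.

Lemma Emb_btype r (u : Y) (g : {ffun Y -> X}) k x : (0 < r)%N -> g \in Emb (r + k) u ->
  x \in ball_set k u -> bt r (g x) = bt r x.
Proof.
rewrite inE => r0 gP xk; symmetry; apply/(btype_eqP halpha) => //.
by exists g => //; apply: (liso_restrict gP xk).
Qed.

Lemma Emb_neq0 r (u : Y) (y : X) : (0 < r)%N -> bt r y = bt r u ->
  Emb r u != set0.
Proof.
move=> r0 /esym /(btype_eqP halpha) [] // g gP gu; apply/set0Pn; exists (finfun g).
by rewrite inE; apply: eq_liso gP => x _; rewrite ffunE.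
Qed.

(** An isomorphism [h] of the [r + k]-ball of [y] onto that of [y'] can be composed with every
    embedding that sends [x] to [y], because the image of the [r]-ball of [u] lies in that ball. *)
Lemma card_Emb_at r k (u x : Y) (y y' : X) : (0 < r)%N -> (k <= r)%N -> x \in ball_set k u ->
  bt (r + k) y = bt (r + k) y' ->
  #|[set g in Emb r u | g x == y]| = #|[set g in Emb r u | g x == y']|.
Proof.
move=> r0 kr xk; have rk0 : (0 < r + k)%N by rewrite addn_gt0 r0.
suff le z z' : bt (r + k) z = bt (r + k) z' ->
    (#|[set g in Emb r u | g x == z]| <= #|[set g in Emb r u | g x == z']|)%N.
  by move=> E; apply/eqP; rewrite eqn_leq !le.
move=> /(btype_eqP halpha) [] // h hP hz.
(* Values outside the ball of [u] are left alone, which keeps the map injective on total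
   functions. *)
pose e (g : {ffun Y -> X}) := [ffun w => if w \in ball_set r u then h (g w) else g w].
have hB (g : {ffun Y -> X}) : g \in Emb r u -> g x = z ->
    liso r (g u) h /\ forall w, w \in ball_set r u -> g w \in ball_set r (g u).
  rewrite inE => gP gx; split; last first.
    by case/lisoP: gP => _ _ <- w; apply: imset_f.
  apply: (@liso_restrict _ _ _ _ _ hP k r) => //; rewrite ball_sym -gx.
  have <- : g @: ball_set k u = ball_set k (g u).
    by apply: (liso_ball gP (ball_refl 0 u)); rewrite addn0.
  exact: imset_f.
rewrite -(card_in_imset (f := e)).
  apply/subset_leq_card/subsetP => g' /imsetP[g + ->]; rewrite inE => /andP[gE /eqP gx].
  have [hg gu] := hB g gE gx; rewrite !inE /e ffunE.
  have xr : x \in ball_set r u by apply: (subsetP (ball_sub u kr)).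
  rewrite xr gx hz eqxx andbT; rewrite inE in gE.
  by apply: eq_liso (liso_comp gE hg) => w wB; rewrite ffunE wB.
move=> g g'; rewrite !inE => /andP[gP /eqP gx] /andP[gP' /eqP gx'] /ffunP E.
apply/ffunP => w; have := E w; rewrite !ffunE; case: ifP => // wB.
have toB (f : {ffun Y -> X}) : liso r u f -> f x = z -> f w \in ball_set (r + k) z.
  move=> fP fx; rewrite addnC; apply: (@ball_trans _ k r _ (f u)).
    rewrite ball_sym -fx.
    have <- : f @: ball_set k u = ball_set k (f u).
      by apply: (liso_ball fP (ball_refl 0 u)); rewrite addn0.
    exact: imset_f.
  by case/lisoP: fP => _ _ <-; apply: imset_f.
by have /lisoP[hi _ _] := hP; apply: hi; apply: toB.
Qed.

(* This is the average over the isomorphisms of the r-ball of u onto balls of X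
   when F only depends on the values in that ball: each isomorphism has the same
   number of extensions to Y. The average is 0 when there is no isomorphism. *)
Definition avg r (u : Y) (F : {ffun Y -> X} -> R) : R :=
  (\sum_(g in Emb r u) F g) / #|Emb r u|%:R.

Lemma avg_le r u (F F' : {ffun Y -> X} -> R) :
  (forall g, g \in Emb r u -> F g <= F' g) -> avg r u F <= avg r u F'.
Proof. by move=> FF; rewrite ler_wpM2r ?invr_ge0 // ler_sum. Qed.

Lemma eq_avg r u (F F' : {ffun Y -> X} -> R) :
  (forall g, g \in Emb r u -> F g = F' g) -> avg r u F = avg r u F'.
Proof. by move=> FF; rewrite /avg (eq_bigr F'). Qed.

Lemma avg_sum (I : Type) (s : seq I) (P : pred I) r u (F : I -> {ffun Y -> X} -> R) :
  avg r u (fun g => \sum_(i <- s | P i) F i g) = \sum_(i <- s | P i) avg r u (F i).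
Proof. by rewrite /avg exchange_big /= mulr_suml. Qed.

Lemma avg_norm r u F : `|avg r u F| <= avg r u (fun g => `|F g|).
Proof.
by rewrite /avg normrM [`|_^-1|]ger0_norm ?invr_ge0 // ler_wpM2r ?invr_ge0 // ler_norm_sum.
Qed.

Lemma avg_const r u (c : R) : Emb r u != set0 -> avg r u (fun=> c) = c.
Proof.
rewrite -card_gt0 => n0.
by rewrite /avg sumr_const -(mulr_natr c) mulfK // pnatr_eq0 -lt0n.
Qed.

Lemma avgB r u F F' : avg r u (fun g => F g - F' g) = avg r u F - avg r u F'.
Proof. by rewrite /avg sumrB mulrBl. Qed.

Lemma avg_set0 r u F : Emb r u = set0 -> avg r u F = 0.
Proof. by move=> E0; rewrite /avg E0 big_set0 mul0r. Qed.

(* By card_Emb_at the law of g x is constant on the classes of bt (r + k). *)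
Lemma avg_cexp r k u x (f : X -> R) : (0 < r)%N -> (k <= r)%N -> x \in ball_set k u ->
  avg r u (fun g => f (g x)) =
  avg r u (fun g => cexp (@bt (r + k) X) f (bt (r + k) (g x))).
Proof.
move=> r0 kr xk; rewrite /avg; congr (_ / _).
pose c y : R := #|[set g in Emb r u | g x == y]|%:R.
have E (F : X -> R) : \sum_(g in Emb r u) F (g x) = \sum_y c y * F y.
  rewrite (partition_big (fun g : {ffun Y -> X} => g x) xpredT) //=.
  apply: eq_bigr => y _; rewrite (eq_bigr (fun=> F y)) => [|g /andP[_ /eqP -> //]].
  rewrite sumr_const -(mulr_natl (F y)) /c; congr (_%:R * _).
  by apply: eq_card => g; rewrite [RHS]inE.
rewrite E (E (fun y => cexp _ f (bt _ y))) sum_cexp // => y z yz.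
by congr _%:R; apply: card_Emb_at yz.
Qed.

Section Pieces.
Variables (K : nat) (Q : Y -> {set Y}).
Hypothesis Q_refl : forall x, x \in Q x.
Hypothesis Q_eq : forall x y, y \in Q x -> Q y = Q x.
Hypothesis Q_ball : forall x, Q x \subset ball_set K x.

Lemma card_Q_gt0 x : (0 < #|Q x|)%N.
Proof. by apply/card_gt0P; exists x. Qed.

Lemma Q_sym x y : (y \in Q x) = (x \in Q y).
Proof. by apply/idP/idP => /Q_eq ->; apply: Q_refl. Qed.

(** Each [x] is counted with weight [1 / #|Q x|], once for each of the [#|Q x|] vertices [u] of its
    piece. *)
Lemma sum_pieces (h : Y -> R) : \sum_u (\sum_(x in Q u) h x) / #|Q u|%:R = \sum_x h x.
Proof.
under eq_bigr => u _ do rewrite mulr_suml.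
rewrite (exchange_big_dep xpredT) //=; apply: eq_bigr => x _.
rewrite (eq_bigr (fun=> h x / #|Q x|%:R)) => [|u /Q_eq -> //].
rewrite (eq_bigl (mem (Q x))) => [|u]; last by rewrite /= Q_sym.
rewrite sumr_const -(mulr_natr (h x / _)) divfK //.
by rewrite pnatr_eq0 -lt0n card_Q_gt0.
Qed.

(* The expected sum over Y of the copy of f obtained by giving every piece a
   uniform vertex u and a random embedding of the r-ball of u in X. *)
Definition transfer r (f : X -> R) : R :=
  \sum_u (\sum_(x in Q u) avg r u (fun g => f (g x))) / #|Q u|%:R.

Section Estimate.
Variables (r : nat) (f : X -> R).
Hypotheses (r0 : (0 < r)%N) (f01 : forall y, 0 <= f y <= 1).

Let q := cexp (@bt r X) f.
Let q' := cexp (@bt (r + K + K) X) f.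
Let D (y : X) := `|q' (bt (r + K + K) y) - q (bt r y)|.
Let W (y : X) := \sum_(z in ball_set K y) D z.

(** By [avg_cexp] the average of [f] is one of [q']; and [q] has the same value at [x] and at [g x],
    since an embedding of the [r + K]-ball of [u] preserves the [r]-ball of [x]. *)
Lemma transfer_at u x : x \in ball_set K u -> Emb (r + K) u != set0 ->
  `|avg (r + K) u (fun g => f (g x)) - q (bt r x)| <=
  avg (r + K) u (fun g => D (g x)).
Proof.
move=> xK E0; rewrite (@avg_cexp _ K) //; try by lia.
rewrite -(avg_const (q (bt r x)) E0) -avgB; apply: le_trans (avg_norm _ _ _) _.
by apply: avg_le => g gE; rewrite -(Emb_btype r0 gE xK).
Qed.

(** The embedding maps the [K]-ball of [u] onto that of [g u], so the sum is the average of
    [W (g u)]. Only the type of [u] matters for it, so its mean over [Y] can be compared with the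
    mean of [W] over [X]. *)
Lemma avg_ball u : Emb (r + K) u != set0 ->
  \sum_(x in ball_set K u) avg (r + K) u (fun g => D (g x)) =
  cexp (@bt (r + K) X) W (bt (r + K) u).
Proof.
move=> E0; rewrite -avg_sum -[RHS](avg_const _ E0).
rewrite (_ : avg _ _ _ = avg (r + K) u (fun g => W (g u))); last first.
  apply: eq_avg => g; rewrite inE => gP; rewrite /W.
  have <- : g @: ball_set K u = ball_set K (g u).
    by apply: (liso_ball gP (ball_refl 0 u)); lia.
  rewrite big_imset // => x y xB yB; have /lisoP[gi _ _] := gP.
  by apply: gi; [move: x xB | move: y yB]; apply/subsetP/ball_sub/leq_addl.
rewrite (@avg_cexp _ 0) ?ball_refl ?addn0 //; last by lia.
apply: eq_avg => g gE; congr cexp.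
apply: (@Emb_btype (r + K) u g 0); rewrite ?addn0 ?ball_refl //; lia.
Qed.

Lemma D01 y : 0 <= D y <= 1.
Proof.
rewrite /D normr_ge0 /= ler_norml.
have [f0 f1] : (forall z, 0 <= f z) /\ (forall z, f z <= 1).
  by split=> z; have /andP[] := f01 z.
have := cexp_ge0 (@bt r X) (bt r y) f0; have := cexp_le (@bt r X) (bt r y) ler01 f1.
have := cexp_ge0 (@bt (r + K + K) X) (bt (r + K + K) y) f0.
have := cexp_le (@bt (r + K + K) X) (bt (r + K + K) y) ler01 f1.
by rewrite -/q -/q' => ? ? ? ?; apply/andP; split; lra.
Qed.

(* With u uniform in Y, the embedded point is nearly uniform in X up to the
   factor of a ball size, so only the mean of D over X matters. *)
Lemma transfer_close (beta kappa : R) rmax :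
  close_stat alpha N beta rmax Y X -> (r + K <= rmax)%N -> 0 <= beta -> 0 <= kappa ->
  \sum_y D y <= #|X|%:R * kappa ->
  `|transfer (r + K) f / #|Y|%:R - (\sum_y f y) / #|X|%:R| <=
  (d.+1 ^ K)%:R * (3 * beta + kappa).
Proof.
move=> cl rr b0 k0 sD; set B : R := (d.+1 ^ K)%:R.
have B1 : 1 <= B by rewrite ler1n expn_gt0.
have rK0 : (0 < r + K <= rmax)%N by rewrite rr andbT addn_gt0 r0.
have rr0 : (0 < r <= rmax)%N by rewrite r0 (leq_trans (leq_addr K r)).
have fin := @mean_cexp_close _ _ _ _ 1 cl rr0 ler01 f01.
have W0 y : 0 <= W y <= B.
  rewrite sumr_ge0 => [|z _]; last by case/andP: (D01 z).
  apply: (@le_trans _ _ (\sum_(z in ball_set K y) 1)).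
    by apply: ler_sum => z _; case/andP: (D01 z).
  by rewrite sumr_const ler_nat card_ball.
have sW : (\sum_y W y) / #|X|%:R <= B * kappa.
  rewrite ler_pdivrMr ?ltr0n // -mulrA [kappa * _]mulrC.
  apply: le_trans (ler_wpM2l _ sD); last by rewrite ler0n.
  rewrite /W (exchange_big_dep xpredT) //= mulr_sumr; apply: ler_sum => z _.
  rewrite (eq_bigl (mem (ball_set K z))) => [|y]; last by rewrite /= ball_sym.
  rewrite sumr_const -(mulr_natl (D z)) ler_wpM2r ?ler_nat ?card_ball //.
  by case/andP: (D01 z).
have fW := @mean_cexp_close _ _ _ _ B cl rK0 (ltW (lt_le_trans ltr01 B1)) W0.
(* The conditional expectation of 1 is 1 at types that occur in [X] and 0 at the others; its defect
   thus accounts for the [u] without embedding. *)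
pose one (y : X) : R := 1.
have f1 := @mean_cexp_close _ _ _ one 1 cl rK0 ler01 (fun=> introT andP (conj ler01 (lexx 1))).
have key u : `|(\sum_(x in Q u) avg (r + K) u (fun g => f (g x))) / #|Q u|%:R
     - (\sum_(x in Q u) q (bt r x)) / #|Q u|%:R| <=
    (1 - cexp (@bt (r + K) X) one (bt (r + K) u)) +
    cexp (@bt (r + K) X) W (bt (r + K) u).
  have Q0 : 0 < #|Q u|%:R :> R by rewrite ltr0n card_Q_gt0.
  have cW0 : 0 <= cexp (@bt (r + K) X) W (bt (r + K) u).
    by apply: cexp_ge0 => y; case/andP: (W0 y).
  have q01 i : 0 <= q i <= 1.
    by rewrite cexp_ge0 ?cexp_le // => y; case/andP: (f01 y).
  have [E0|E0] := eqVneq (Emb (r + K) u) set0.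
    rewrite (cexp_out one) => [|y]; last first.
      apply/eqP => yu; have rK : (0 < r + K)%N by rewrite addn_gt0 r0.
      by move: (Emb_neq0 rK yu); rewrite E0 eqxx.
    rewrite big1 ?mul0r ?sub0r => [|x _]; last exact: avg_set0.
    rewrite normrN ger0_norm ?divr_ge0 ?sumr_ge0 // => [|x _]; last first.
      by case/andP: (q01 (bt r x)).
    rewrite subr0; apply: le_trans (_ : 1 <= _); last by lra.
    rewrite ler_pdivrMr // mul1r -sumr_const.
    by apply: ler_sum => x _; case/andP: (q01 (bt r x)).
  have c1 : cexp (@bt (r + K) X) one (bt (r + K) u) <= 1 by apply: cexp_le.
  apply: (@le_trans _ _ (cexp (@bt (r + K) X) W (bt (r + K) u))); last by lra.
  set S := \sum_(x in Q u) (avg (r + K) u (fun g => f (g x)) - q (bt r x)).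
  have -> : (\sum_(x in Q u) avg (r + K) u (fun g => f (g x))) / #|Q u|%:R -
      (\sum_(x in Q u) q (bt r x)) / #|Q u|%:R = S / #|Q u|%:R.
    by rewrite /S sumrB mulrBl.
  have -> : `|S / #|Q u|%:R| = `|S| / #|Q u|%:R by rewrite normrM (gtr0_norm (x := _^-1)) ?invr_gt0.
  (* The gain from dividing by the size of the piece is given up, and the piece is enlarged to the
     [K]-ball, where [avg_ball] applies. *)
  apply: (@le_trans _ _ `|S|).
    by rewrite ler_piMr // invf_le1 // ler1n card_Q_gt0.
  apply: le_trans (ler_norm_sum _ _ _) _; rewrite -avg_ball //.
  rewrite [leRHS](bigID (mem (Q u))) /=.
  rewrite [X in X + _](eq_bigl (mem (Q u))) => [|x]; last first.
    by rewrite /= andb_idl //; apply: (subsetP (Q_ball u)).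
  rewrite -[leLHS]addr0 lerD //.
    by apply: ler_sum => x xQ; apply: transfer_at => //; apply: (subsetP (Q_ball u)).
  apply: sumr_ge0 => x _; rewrite divr_ge0 // sumr_ge0 // => g _.
  by case/andP: (D01 (g x)).
have sum_key : `|transfer (r + K) f - \sum_(x : Y) q (bt r x)| <=
    #|Y|%:R - \sum_(u : Y) cexp (@bt (r + K) X) one (bt (r + K) u) +
    \sum_(u : Y) cexp (@bt (r + K) X) W (bt (r + K) u).
  rewrite -(sum_pieces (fun x => q (bt r x))) /transfer -sumrB.
  apply: le_trans (ler_norm_sum _ _ _) _.
  apply: le_trans (ler_sum _ (fun u _ => key u)) _.
  by rewrite big_split /= sumrB sumr_const.
have nY : 0 < #|Y|%:R :> R by rewrite ltr0n.
have {}sum_key : `|transfer (r + K) f / #|Y|%:R - (\sum_(x : Y) q (bt r x)) / #|Y|%:R| <=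
    1 - (\sum_(u : Y) cexp (@bt (r + K) X) one (bt (r + K) u)) / #|Y|%:R +
    (\sum_(u : Y) cexp (@bt (r + K) X) W (bt (r + K) u)) / #|Y|%:R.
  rewrite -mulrBl normrM (gtr0_norm (x := #|Y|%:R^-1)) ?invr_gt0 // ler_pdivrMr //.
  by rewrite mulrDl mulrBl !divfK ?gt_eqF // mul1r.
have one1 : (\sum_y one y) / #|X|%:R = 1.
  by rewrite sumr_const divff // pnatr_eq0 -lt0n.
move: f1 fW fin sum_key sW; rewrite one1 -/q.
move: ((\sum_u cexp _ one _) / _) ((\sum_u cexp _ W _) / _) ((\sum_x q _) / _).
move: ((\sum_y W y) / _) ((\sum_y f y) / _) (transfer _ _ / _).
move=> a b c x y z; rewrite !ler_norml => /andP[? ?] /andP[? ?] /andP[? ?] /andP[? ?] ?.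
(* The comparisons for [f], [one] and [W] cost [beta], [beta] and [B * beta]. *)
have : beta <= B * beta by rewrite ler_peMl.
move=> ?; apply/andP; split; lra.
Qed.

End Estimate.
End Pieces.
End Stats.

(** One step adds [2 * K]: from the radius [r] preserved at [x] to [r + K] embedded at [u], then to
    [r + K + K], where the law of [g x] is described. The 1 keeps the radius positive, as types
    require. *)
Definition scale K j := ((j.*2) * K + 1)%N.

Lemma scaleS K j : scale K j.+1 = (scale K j + K + K)%N.
Proof. by rewrite /scale doubleS !mulSn; lia. Qed.

Lemma scale_le K j L : (j < L)%N -> (scale K j + K <= scale K L)%N.
Proof.
move=> jL; have : (j.*2.+1 * K <= L.*2 * K)%N by rewrite leq_mul2r; lia.
by rewrite /scale mulSn; lia.
Qed.

(* The squared norms of the conditional expectations given the ball types are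
   bounded and increase with the radius, so they are almost stationary at one
   of the L scales. *)
Lemma transfer_mean (K : nat) (S : finType) (err : R) : 0 < err ->
  exists (beta : R) L, [/\ 0 < beta, (0 < L)%N & forall X Y : sgraph,
    max_degree_le d X -> max_degree_le d Y -> (0 < #|X|)%N -> (0 < #|Y|)%N ->
    close_stat alpha N beta (scale K L) Y X ->
    forall (Q : Y -> {set Y}), (forall x, x \in Q x) ->
    (forall x y, y \in Q x -> Q y = Q x) -> (forall x, Q x \subset ball_set K x) ->
    forall f : S -> X -> R, (forall s y, 0 <= f s y <= 1) ->
    exists2 j, (j < L)%N & forall s,
      `|transfer Q (scale K j + K) (f s) / #|Y|%:R - (\sum_y f s y) / #|X|%:R| <= err].
Proof.
move=> err0; set B : R := (d.+1 ^ K)%:R.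
have B0 : 0 < B by rewrite ltr0n expn_gt0.
pose kappa := err / (2 * B); pose beta := err / (6 * B).
have k0 : 0 < kappa by rewrite divr_gt0 // mulr_gt0.
have b0 : 0 < beta by rewrite divr_gt0 // mulr_gt0.
(* The total energy is at most [#|S|], so with this [L] some increment is at most [kappa ^+ 2];
   [kappa] and [beta] are such that [B * (3 * beta + kappa)] is [err]. *)
pose L := (Num.truncn (#|S|%:R / kappa ^+ 2)).+1.
have LP : #|S|%:R / L%:R <= kappa ^+ 2.
  rewrite ler_pdivrMr ?ltr0n // mulrC -ler_pdivrMr ?exprn_gt0 //.
  by apply/ltW/truncnS_gt.
exists beta, L; split=> // X Y dX dY X0 Y0 cl Q Q1 Q2 Q3 f f01.
have nX : 0 < #|X|%:R :> R by rewrite ltr0n.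
pose p j s (y : X) := cexp (@bt (scale K j) X) (f s) (bt (scale K j) y).
have p01 j s y : 0 <= p j s y <= 1.
  by rewrite /p cexp_ge0 ?cexp_le // => z; case/andP: (f01 s z).
(* The energies of all test functions are added, so that a single scale serves them all. *)
pose e j := \sum_s (\sum_y p j s y ^+ 2) / #|X|%:R.
have e0 : 0 <= e 0%N.
  by apply: sumr_ge0 => s _; rewrite divr_ge0 // sumr_ge0 // => y _; apply: sqr_ge0.
have eL : e L <= #|S|%:R.
  rewrite -[leRHS]sumr_const; apply: ler_sum => s _; rewrite ler_pdivrMr // mul1r.
  rewrite -[leRHS]sumr_const; apply: ler_sum => y _; rewrite expr_le1 //.
    by case/andP: (p01 L s y).
  by case/andP: (p01 L s y).
have [j jL ej] := small_increment (isT : (0 < L)%N) e0 eL.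
exists j => // s; set r := scale K j.
have rE : scale K j.+1 = (r + K + K)%N by apply: scaleS.
have r0 : (0 < r)%N by rewrite /r /scale addn1.
have D2 t : \sum_y (p j.+1 t y - p j t y) ^+ 2 =
    \sum_y p j.+1 t y ^+ 2 - \sum_y p j t y ^+ 2.
  apply: cexp_energy => y z; apply: btype_refine => //.
  by rewrite rE -addnA leq_addr.
have sD : \sum_y `|p j.+1 s y - p j s y| <= #|X|%:R * kappa.
  apply: sum_norm_le => //; rewrite -ler_pdivrMl // mulrC.
  apply: le_trans LP; apply: le_trans ej; rewrite /e -sumrB (bigD1 s) //=.
  rewrite -mulrBl -D2 -[leLHS]addr0 lerD // sumr_ge0 // => t _.
  by rewrite -mulrBl -D2 divr_ge0 // sumr_ge0 // => y _; apply: sqr_ge0.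
have rL : (r + K <= scale K L)%N by apply: scale_le.
rewrite /p rE -/r in sD.
have := transfer_close dX dY X0 Y0 Q1 Q2 Q3 r0 (f01 s) cl rL (ltW b0) (ltW k0) sD.
move/le_trans; apply; rewrite -/B /beta /kappa.
by rewrite le_eqVlt; apply/orP; left; apply/eqP; field; rewrite gt_eqF.
Qed.

End Transfer.

(** * Partitions into small classes *)

Section KeptEdges.
Variable G : sgraph.
Implicit Type a : rel G.

Definition cut_degree a (x : G) : nat := #|[set y | adj x y && ~~ a x y]|.

(* Ordered pairs: each removed edge is counted twice. *)
Definition cuts a : nat := \sum_x cut_degree a x.

Definition kclass a (x : G) : {set G} := [set y | connect a x y].

(** Encoding a partition by its kept edges makes the classes connected, so that each lies in a
    [K]-ball. *)
Definition kpartition (K : nat) a : Prop :=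
  [/\ symmetric a, subrel a (@adj G) & forall x, (#|kclass a x| <= K)%N].

Lemma card_pairs (S : rel G) :
  #|[set p : G * G | S p.1 p.2]| = \sum_x #|[set y | S x y]|.
Proof.
rewrite -sum1_card (eq_bigl (fun p => S p.1 p.2)) => [|p]; last by rewrite inE.
rewrite -(pair_big_dep xpredT S (fun _ _ => 1%N)) /=; apply: eq_bigr => x _.
by rewrite -sum1_card; apply: eq_bigl => y; rewrite inE.
Qed.

Lemma connect_inv a (P : pred G) (x y : G) : P x ->
  (forall z w, P z -> a z w -> P w) -> connect a x y -> P y.
Proof.
move=> Px Pa /connectP[p xp ->]; elim: p x Px xp => //= z p IH x Px /andP[xz zp].
by apply: IH zp; apply: Pa xz.
Qed.

Lemma kclass_refl a x : x \in kclass a x.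
Proof. by rewrite inE connect0. Qed.

Lemma kclass_eq a x y : symmetric a -> y \in kclass a x -> kclass a y = kclass a x.
Proof.
rewrite inE => as_ xy; apply/setP => z; rewrite !inE.
exact/esym/(same_connect (sym_connect_sym as_)).
Qed.

Lemma kclass_ball K a x : kpartition K a -> kclass a x \subset ball_set K x.
Proof.
move=> [_ sub le_K]; apply/subsetP => y; rewrite inE; apply: connect_ball sub _.
exact: le_K.
Qed.

Lemma kpartition_discrete K : (0 < K)%N -> kpartition K (fun _ _ => false).
Proof.
move=> K0; split=> // x; rewrite (_ : kclass _ x = [set x]%SET) ?cards1 //.
apply/setP => y; rewrite !inE; apply/idP/eqP => [|->]; last exact: connect0.
by move=> /(@connect_inv (fun _ _ => false) (pred1 x)) H; apply/eqP/H => /=.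
Qed.

Lemma adj_del_edges (F : {set {set G}}) (x y : G) :
  adj (s := del_edges F) x y = adj x y && ([set x; y]%SET \notin F).
Proof.
have := @set_adj_imset G (@adj G) x y (@adj_sym G) (@adj_irr G).
rewrite /set_adj -/(edges G) /= /set_adj inE => <-.
by case: (x != y); rewrite //= andbC.
Qed.

Lemma kpartition_edges K a : kpartition K a ->
  exists F : {set {set G}},
    [/\ F \subset edges G, (2 * #|F| <= cuts a)%N & @adj (del_edges F) =2 a].
Proof.
move=> [as_ sub _]; pose c x y := adj x y && ~~ a x y.
have cs : symmetric c by move=> x y; rewrite /c adj_sym as_.
have ci : irreflexive c by move=> x; rewrite /c adj_irr.
pose D := [set p : G * G | c p.1 p.2]; pose pr (p : G * G) := [set p.1; p.2]%SET.
exists (pr @: D); split.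
- apply/subsetP => e /imsetP[p + ->]; rewrite inE => /andP[xy _].
  by apply/imsetP; exists p; rewrite ?inE.
- rewrite /cuts -(card_pairs c) -/D mulnC -sum_nat_const -sum1_card.
  rewrite (partition_big pr (mem (pr @: D))) /=; last by move=> p; apply: imset_f.
  apply: leq_sum => _ /imsetP[[x y] xyD ->].
  have yxD : (y, x) \in D by rewrite inE cs; rewrite inE in xyD.
  have xy : x != y by apply: contraTneq xyD => ->; rewrite inE /= ci.
  rewrite sum1_card -(_ : #|[set (x, y); (y, x)]%SET| = 2%N); last first.
    by rewrite cards2 xpair_eqE (negPf xy).
  apply/subset_leq_card/subsetP => q.
  rewrite !inE => /orP[] /eqP ->; rewrite unfold_in /=; apply/andP; split=> //.
  by rewrite /pr /= setUC.
- move=> x y; rewrite adj_del_edges; have := @set_adj_imset G c x y cs ci.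
  have [->|xy] := eqVneq x y.
    by rewrite adj_irr /=; case E: (a y y) => //; have := sub _ _ E; rewrite adj_irr.
  rewrite /set_adj xy /= => -> /=; rewrite /c.
  have := sub x y; case: (@adj G x y) (a x y) => [] [] //= H; by have := H isT.
Qed.

End KeptEdges.

Lemma sum_card_degree (d : nat) (G : sgraph) (U : {set G}) : max_degree_le d G ->
  (\sum_(x in U) #|[set y | adj x y]| <= d * #|U|)%N.
Proof.
by move=> dG; rewrite mulnC -sum_nat_const; apply: leq_sum => x _; apply: dG.
Qed.

Lemma kpartition_of_separator (d K : nat) (G : sgraph) (Z : {set G}) :
  max_degree_le d G ->
  components_le K (del_edges [set e in edges G | ~~ [disjoint e & Z]]%SET) ->
  exists2 a : rel G, kpartition K a & (cuts a <= 2 * (d * #|Z|))%N.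
Proof.
move=> dG cK; set F := [set e in _ | _]%SET in cK.
pose a : rel G := fun x y => adj (s := del_edges F) x y.
exists a; first split.
- by move=> x y; apply: adj_sym.
- by move=> x y; rewrite /a adj_del_edges => /andP[].
- exact: cK.
pose c (x y : G) := adj x y && ((x \in Z) || (y \in Z)).
have sum_c : cuts a = \sum_x #|[set y | adj x y && ~~ a x y]| by [].
rewrite sum_c -(card_pairs (fun x y => adj x y && ~~ a x y)).
pose c1 := [set p : G * G | (p.1 \in Z) && adj p.1 p.2].
pose c2 := [set p : G * G | (p.2 \in Z) && adj p.1 p.2].
apply: (@leq_trans #|c1 :|: c2|).
  apply/subset_leq_card/subsetP => -[x y]; rewrite !inE /= /a adj_del_edges.
  move=> /andP[xy]; rewrite xy /= negbK andbT andbT inE => /andP[_].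
  rewrite -setI_eq0 => /set0Pn[z]; rewrite !inE => /andP[/orP[]/eqP-> ->] //.
  by rewrite orbT.
apply: leq_trans (leq_card_setU _ _) _; rewrite mul2n -addnn.
have c1E : (#|c1| <= d * #|Z|)%N.
  rewrite (card_pairs (fun x y => (x \in Z) && adj x y)).
  apply: leq_trans (sum_card_degree Z dG); rewrite [leqRHS]big_mkcond /=.
  apply: leq_sum => x _; case: ifP => [_|xZ] //=.
  by rewrite leqn0 cards_eq0; apply/eqP/setP => y; rewrite !inE.
apply: leq_add => //; rewrite (_ : #|c2| = #|c1|) //.
rewrite -(card_imset (f := fun p : G * G => (p.2, p.1))); last by move=> [? ?] [? ?] [-> ->].
apply: eq_card => -[x y]; apply/imsetP/idP => [[[z w]]|].
  by rewrite !inE /= => /andP[wZ zw] [-> ->]; rewrite wZ adj_sym.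
by rewrite inE /= => /andP[xZ xy]; exists (y, x); rewrite // inE /= xZ adj_sym.
Qed.

Definition boundary (G : sgraph) (W U : {set G}) : nat :=
  #|[set p : G * G | [&& p.1 \in W, p.2 \in U & adj p.1 p.2]]|.

(** Sets [W] are split off one after the other. Each pays its boundary inside the current [U], in
    both directions, which makes [2 * kappa] per vertex; once [U] has density below [kappa], all its
    edges are dropped, at most [d * kappa * #|G|] ordered pairs. *)
Lemma greedy_partition (R : realType) (d K : nat) (kappa : R) (G : sgraph) :
  max_degree_le d G -> 0 < kappa -> (0 < K)%N ->
  (forall U : {set G}, kappa * #|G|%:R <= #|U|%:R ->
     exists W : {set G}, [/\ W \subset U, W != set0, (#|W| <= K)%N &
       (boundary W (U :\: W))%:R <= kappa * #|W|%:R]) ->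
  exists2 a : rel G, kpartition K a & (cuts a)%:R <= (2 + d%:R) * kappa * #|G|%:R.
Proof.
move=> dG k0 K0 good.
(* Only pairs inside [U] are counted: edges to the sets split off earlier are already paid for. *)
suff H m (U : {set G}) : (#|U| <= m)%N -> exists a : rel G,
    [/\ kpartition K a, forall x y, a x y -> (x \in U) && (y \in U) &
     #|[set p : G * G | [&& p.1 \in U, p.2 \in U, adj p.1 p.2 & ~~ a p.1 p.2]]|%:R
       <= 2 * kappa * #|U|%:R + d%:R * kappa * #|G|%:R].
  have [a [aK _ ac]] := H _ [set: G]%SET (leqnn _); exists a => //.
  rewrite /cuts -(card_pairs (fun x y => adj x y && ~~ a x y)).
  move: ac; rewrite cardsT (_ : [set p : G * G | _] = [set p | adj p.1 p.2 && ~~ a p.1 p.2]%SET).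
    by move/le_trans; apply; rewrite le_eqVlt; apply/orP; left; apply/eqP; ring.
  by apply/setP => p; rewrite !inE.
elim: m U => [|m IH] U Um.
  move: Um; rewrite leqn0 cards_eq0 => /eqP ->; exists (fun _ _ => false); split=> //.
    exact: kpartition_discrete.
  rewrite (_ : [set p : G * G | _] = set0) ?cards0; last first.
    by apply/setP => p; rewrite !inE.
  by rewrite mulr0 add0r mulr_ge0 // mulr_ge0 // ltW.
have [small|/good[W [WU W0 WK Wb]]] := ltP #|U|%:R (kappa * #|G|%:R).
  exists (fun _ _ => false); split=> //.
    exact: kpartition_discrete.
  have : (#|[set p : G * G | [&& p.1 \in U, p.2 \in U, adj p.1 p.2 & ~~ false]]|
      <= d * #|U|)%N.
    apply: leq_trans (sum_card_degree U dG).
    rewrite (card_pairs (fun x y => [&& x \in U, y \in U, adj x y & ~~ false])).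
    rewrite [leqRHS]big_mkcond /=; apply: leq_sum => x _; case: ifP => [_|xU].
      by apply/subset_leq_card/subsetP => y; rewrite !inE => /and4P[_ _ ->].
    by rewrite leqn0 cards_eq0; apply/eqP/setP => y; rewrite !inE.
  rewrite -(ler_nat R) natrM => /le_trans; apply.
  have h1 : 0 <= 2 * kappa * #|U|%:R by rewrite !mulr_ge0 // ltW.
  have h2 : d%:R * #|U|%:R <= d%:R * (kappa * #|G|%:R) by rewrite ler_wpM2l // ltW.
  by lra.
have UW : (#|U :\: W| <= m)%N.
  rewrite cardsD (setIidPr WU) leq_subLR; apply: leq_trans Um _.
  by rewrite -add1n leq_add2r card_gt0.
have [a' [[as' asub aK] aU ac]] := IH _ UW.
pose b x y := [&& x \in W, y \in W & adj x y].
pose a x y := b x y || a' x y.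
have a'W x y : a' x y -> (x \notin W) && (y \notin W).
  by move=> /aU; rewrite !inE => /andP[/andP[-> _] /andP[-> _]].
exists a; split.
- split.
  + by move=> x y; rewrite /a /b adj_sym as' andbCA.
  + by move=> x y /orP[/and3P[]|/asub].
  + move=> x; have [xW|xW] := boolP (x \in W).
      apply: leq_trans WK; apply/subset_leq_card/subsetP => y; rewrite inE.
      apply: (connect_inv (P := mem W)) => // z w /= zW /orP[/and3P[] //|/a'W].
      by rewrite zW.
    apply: leq_trans (aK x); apply/subset_leq_card/subsetP => y; rewrite !inE.
    move=> /(connect_inv (P := fun z => (z \notin W) && connect a' x z)).
    case/(_ _ _)/andP => //; first by rewrite xW connect0.
    move=> z w /andP[zW xz] /orP[/and3P[]|zw]; first by rewrite (negPf zW).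
    have /andP[_ ->] := a'W _ _ zw.
    by apply: connect_trans xz (connect1 zw).
- move=> x y /orP[/and3P[xW yW _]|/aU].
    by rewrite !(subsetP WU).
  by rewrite !inE => /andP[/andP[_ ->] /andP[_ ->]].
pose A1 := [set p : G * G | [&& p.1 \in W, p.2 \in U :\: W & adj p.1 p.2]].
pose A2 := [set p : G * G | [&& p.2 \in W, p.1 \in U :\: W & adj p.1 p.2]].
pose A3 := [set p : G * G | [&& p.1 \in U :\: W, p.2 \in U :\: W, adj p.1 p.2 & ~~ a' p.1 p.2]].
have A12 : #|A2| = #|A1|.
  rewrite -(card_imset (f := fun p : G * G => (p.2, p.1))); last by move=> [? ?] [? ?] [-> ->].
  apply: eq_card => -[x y]; apply/imsetP/idP => [[[z w] + [-> ->]]|].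
    by rewrite !inE /= => /and3P[-> ->]; rewrite adj_sym => ->.
  by rewrite inE /= => /and3P[xW yU xy]; exists (y, x); rewrite // inE /= xW yU adj_sym.
have le3 : (#|[set p : G * G | [&& p.1 \in U, p.2 \in U, adj p.1 p.2 & ~~ a p.1 p.2]]|
    <= #|A1| + #|A1| + #|A3|)%N.
  apply: (@leq_trans #|A1 :|: A2 :|: A3|).
    apply/subset_leq_card/subsetP => -[x y]; rewrite !inE /= /a /b.
    by case/and4P => -> -> ->; case: (x \in W); case: (y \in W).
  apply: leq_trans (leq_card_setU _ _) _; rewrite leq_add2r -{2}A12.
  exact: leq_card_setU.
move: le3; rewrite -(ler_nat R) !natrD => /le_trans; apply.
have cU : #|U|%:R = #|W|%:R + #|U :\: W|%:R :> R.
  by rewrite -natrD -(cardsID W U) (setIidPr WU).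
rewrite /boundary -/A1 in Wb; rewrite -/A3 in ac; rewrite cU; lra.
Qed.

(** * Graphs close to a hyperfinite family *)

Section HyperfiniteNeighbour.
Variables (R : realType) (d : nat) (alpha : nat -> nat * rooted_graph).
Hypothesis halpha : enumerates_U d alpha.
Variable N : nat -> nat.
Hypothesis btype_lt : forall r (G : sgraph) (u : G), (0 < r)%N ->
  max_degree_le d G -> (btype alpha r u < N r)%N.

(** An edge from the copy of [Q] to the rest of [U] lifts to an edge leaving [Q]: as [K < r], its
    outer end is still in the image of the ball. *)
Lemma liso_boundary (Y X : sgraph) (K r : nat) (u : Y) (g : Y -> X)
    (Q : {set Y}) (U : {set X}) :
  liso r u g -> Q \subset ball_set K u -> (K < r)%N ->
  (boundary ((g @: Q) :&: U) (U :\: ((g @: Q) :&: U)) <= boundary Q (~: Q))%N.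
Proof.
move=> gP QK Kr; have /lisoP[gi ga gb] := gP.
have QB x : x \in Q -> x \in ball_set K u by apply/subsetP.
have KB x : x \in ball_set K u -> x \in ball_set r u.
  by apply/subsetP/ball_sub/ltnW.
rewrite /boundary; set B := [set p : Y * Y | _].
apply: leq_trans (leq_imset_card (fun p => (g p.1, g p.2)) B).
apply/subset_leq_card/subsetP => -[w w']; rewrite inE /= => /and3P[].
rewrite inE => /andP[/imsetP[x xQ ->] gxU]; rewrite !inE => /andP[w'W w'U] gxw'.
have gxK : g x \in ball_set K (g u).
  have <- : g @: ball_set K u = ball_set K (g u).
    by apply: (liso_ball gP (ball_refl 0 u)); rewrite addn0 ltnW.
  by rewrite imset_f ?QB.
have : w' \in ball_set r (g u).
  by apply: (subsetP (ball_sub _ Kr)); apply: ballS_adj gxw'.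
rewrite -gb => /imsetP[y yB w'E]; apply/imsetP; exists (x, y); last by rewrite w'E.
rewrite inE /= xQ inE -(ga x y (KB x (QB x xQ)) yB) -w'E gxw' andbT.
by apply: contra w'W => yQ; rewrite w'U andbT w'E imset_f.
Qed.

Lemma boundary_sum (G : sgraph) (a : rel G) (x : G) : symmetric a ->
  (boundary (kclass a x) (~: kclass a x) <= \sum_(y in kclass a x) cut_degree a y)%N.
Proof.
move=> as_; rewrite /boundary.
rewrite (card_pairs (fun z w => [&& z \in kclass a x, w \in ~: kclass a x & adj z w])).
rewrite [leqRHS]big_mkcond /=; apply: leq_sum => y _; case: ifP => [yx|yx].
  apply/subset_leq_card/subsetP => z; rewrite !inE /= => /andP[xz ->] /=.
  apply: contra xz => yz; rewrite inE in yx.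
  exact: connect_trans yx (connect1 yz).
by rewrite leqn0 cards_eq0; apply/eqP/setP => z; rewrite !inE.
Qed.

Lemma avg_le_const (X Y : sgraph) r (u : Y) (F : {ffun Y -> X} -> R) (c : R) :
  0 <= c -> (forall g, g \in Emb X r u -> F g <= c) -> avg r u F <= c.
Proof.
move=> c0 Fc; have [E0|E0] := eqVneq (Emb X r u) set0; first by rewrite avg_set0.
by rewrite -[leRHS](avg_const c E0); apply: avg_le.
Qed.

Lemma hyperfinite_kpartition (P : sgraph -> Prop) :
  (forall G, P G -> max_degree_le d G) -> hyperfinite R P ->
  forall eps : R, 0 < eps -> exists K, (0 < K)%N /\ forall G, P G ->
    (0 < #|G|)%N /\ exists2 a : rel G, kpartition K a & (cuts a)%:R <= eps * #|G|%:R.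
Proof.
move=> Pd hP eps e0; have e1 : 0 < eps / (2 * d.+1%:R) by rewrite divr_gt0 // mulr_gt0.
have [K [K0 KP]] := hP _ e1; exists K; split=> // G GP.
have [Z [Zlt Zc]] := KP G GP; split.
  (* The strict inequality for [Z] rules out the graph without vertices. *)
  rewrite lt0n; apply: contraTneq Zlt => ->.
  by rewrite mulr0 -leNgt.
have [a aK ac] := kpartition_of_separator (Pd G GP) Zc; exists a => //.
have : (cuts a)%:R <= (2 * (d.+1 * #|Z|))%:R :> R.
  by rewrite ler_nat (leq_trans ac) // leq_mul2l /= leq_mul2r leqnSn orbT.
move=> /le_trans; apply; rewrite !natrM.
have := ltW Zlt; rewrite -(ler_pM2l (_ : 0 < 2 * d.+1%:R :> R)); last by rewrite mulr_gt0.
rewrite mulrA => /le_trans; apply.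
have D0 : 0 < d.+1%:R :> R by [].
rewrite le_eqVlt; apply/orP; left; apply/eqP; move: (d.+1%:R : R) D0 => D D0.
by field; rewrite gt_eqF.
Qed.

(* If H has no such partition, the greedy procedure leaves a set U in which
   every small subset has large boundary. Its indicator function can be moved
   to G, where it contradicts the partition of G into pieces with few boundary
   edges. *)
Lemma hyperfinite_close (P : sgraph -> Prop) :
  (forall G, P G -> max_degree_le d G) -> hyperfinite R P ->
  forall eps : R, 0 < eps -> exists K (beta : R) rmax, [/\ (0 < K)%N, 0 < beta &
    forall G H : sgraph, P G -> max_degree_le d H -> (0 < #|H|)%N ->
      close_stat alpha N beta rmax G H ->
      exists2 a : rel H, kpartition K a & (cuts a)%:R <= eps * #|H|%:R].
Proof.
move=> Pd hP eps e0; have d2 : 0 < 2 + d%:R :> R by rewrite ltr_wpDr.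
pose kappa : R := eps / (2 + d%:R); have k0 : 0 < kappa by rewrite divr_gt0.
(* [U] has density at least [kappa] in [H], so its copy has mean density at least [kappa / 2] in
   [G], and each copied vertex forces [kappa] cut pairs on average. The cuts of [G] would reach
   [kappa ^+ 2 / 2] per vertex; any smaller bound is contradictory. *)
have e1 : 0 < kappa ^+ 2 / 4 by rewrite divr_gt0 ?exprn_gt0.
have [K [K0 KP]] := hyperfinite_kpartition Pd hP e1.
have kh0 : 0 < kappa / 2 by rewrite divr_gt0.
have [beta [L [b0 L0 tr]]] := transfer_mean halpha btype_lt K unit kh0.
exists K, beta, (scale K L); split=> // G H GP dH H0 cl.
have [G0 [a aK ac]] := KP G GP; have dG := Pd G GP; have [as_ _ aK'] := aK.
suff [b bK bc] : exists2 b : rel H, kpartition K b &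
    (cuts b)%:R <= (2 + d%:R) * kappa * #|H|%:R.
  by exists b => //; rewrite (le_trans bc) // /kappa [_ * (eps / _)]mulrC divfK ?gt_eqF.
apply: greedy_partition => // U Ubig; apply: contrapT => bad.
have {}bad (W : {set H}) : W \subset U -> (#|W| <= K)%N ->
    kappa * #|W|%:R <= (boundary W (U :\: W))%:R.
  move=> WU WK; have [->|W0] := eqVneq W set0; first by rewrite cards0 mulr0.
  by rewrite leNgt; apply/negP => Wb; apply: bad; exists W; split=> //; apply: ltW.
have nG : 0 < #|G|%:R :> R by rewrite ltr0n.
have nH : 0 < #|H|%:R :> R by rewrite ltr0n.
pose f (_ : unit) (y : H) : R := (y \in U)%:R.
have f01 s y : 0 <= f s y <= 1 by rewrite ler0n lern1 leq_b1.
have Qb x : kclass a x \subset ball_set K x by apply: kclass_ball.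
have [j jL /(_ tt)] := tr H G dH dG H0 G0 cl (kclass a) (kclass_refl a)
  (fun x y => kclass_eq as_) Qb f f01.
set r := (scale K j + K)%N => trf.
have Kr : (K < r)%N by rewrite /r /scale addnAC addn1 ltnS leq_addl.
have sumf : \sum_y f tt y = #|U|%:R.
  rewrite -sum1_card natr_sum [in RHS]big_mkcond /=.
  by apply: eq_bigr => y _; rewrite /f; case: (y \in U).
(* The trace on [U] of a copied class has at most [K] vertices, so [bad] bounds its boundary from
   below, and [liso_boundary] bounds it from above by the cut edges of the class. *)
have key : kappa * transfer (kclass a) r (f tt) <= (cuts a)%:R.
  rewrite /cuts natr_sum -(sum_pieces (kclass_refl a) (fun x y => kclass_eq as_)).
  rewrite /transfer mulr_sumr; apply: ler_sum => u _; rewrite mulrA.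
  rewrite ler_wpM2r ?invr_ge0 // -avg_sum -natr_sum.
  rewrite mulrC -ler_pdivlMr //; apply: avg_le_const => [|g]; first by rewrite divr_ge0 // ltW.
  rewrite inE => gP; rewrite ler_pdivlMr // mulrC.
  have /lisoP[gi _ _] := gP; pose W := (g @: kclass a u) :&: U.
  have -> : \sum_(x in kclass a u) f tt (g x) = #|W|%:R.
    rewrite -(big_imset (f tt)); last first.
      have QB z : z \in kclass a u -> z \in ball_set r u.
        by move=> zu; apply: (subsetP (ball_sub u (ltnW Kr))); apply: (subsetP (Qb u)).
      by move=> x y /QB xB /QB yB; apply: gi.
    rewrite /= -sum1_card natr_sum [RHS]big_mkcond [LHS]big_mkcond /=.
    by apply: eq_bigr => y _; rewrite inE /f; case: (y \in U); rewrite ?andbF ?andbT ?if_same.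
  apply: (@le_trans _ _ (boundary W (U :\: W))%:R).
    apply: bad; first exact: subsetIr.
    apply: leq_trans (aK' u); apply: leq_trans (leq_imset_card g (kclass a u)).
    by apply/subset_leq_card/subsetIl.
  rewrite ler_nat; apply: leq_trans (boundary_sum u as_).
  exact: liso_boundary gP (Qb u) Kr.
have dens : kappa <= #|U|%:R / #|H|%:R by rewrite ler_pdivlMr.
move: trf; rewrite sumf ler_norml => /andP[trf _].
have {trf} : kappa / 2 <= transfer (kclass a) r (f tt) / #|G|%:R by lra.
rewrite ler_pdivlMr // => trf.
have : kappa * (kappa / 2 * #|G|%:R) <= kappa ^+ 2 / 4 * #|G|%:R.
  by apply: le_trans ac; apply: le_trans key; rewrite ler_pM2l.
rewrite mulrA ler_pM2r //; have : 0 < kappa ^+ 2 by rewrite exprn_gt0.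
by lra.
Qed.

End HyperfiniteNeighbour.

(** * Rounding and pullback of partitions *)

(** First-moment method. The positive weight certifies that the choice lies in the support of the
    law. *)
Lemma weighted_min (R : realType) (O : finType) (w F : O -> R) (M : R) :
  (forall o, 0 <= w o) -> \sum_o w o = 1 -> \sum_o w o * F o <= M ->
  exists2 o, 0 < w o & F o <= M.
Proof.
move=> w0 w1 FM; apply: contrapT => noo.
have H o : w o * M <= w o * F o.
  have [-> |wo] := eqVneq (w o) 0; first by rewrite !mul0r.
  rewrite ler_wpM2l //; apply/ltW; rewrite ltNge; apply/negP => Fo; apply: noo.
  by exists o; rewrite // lt_def wo w0.
have eqM : \sum_o w o * M = M by rewrite -mulr_suml w1 mul1r.
have [o wo] : exists o, 0 < w o.
  apply: contrapT => wo; have : \sum_o w o = 0.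
    apply: big1 => o _; apply/eqP; rewrite eq_le w0 andbT leNgt.
    by apply/negP => ?; apply: wo; exists o.
  by rewrite w1 => /eqP; rewrite oner_eq0.
have : \sum_o w o * M < \sum_o w o * F o.
  rewrite (bigD1 o) //= [ltRHS](bigD1 o) //= ltr_leD //.
    rewrite ltr_pM2l // ltNge; apply/negP => Fo; apply: noo; by exists o.
  by apply: ler_sum => p _.
by rewrite eqM ltNge FM.
Qed.

(* A random choice has variance at most #|S| * B^2 per index. *)
Lemma rounding (R : realType) (I O S : finType) (w : I -> O -> R)
    (v : I -> O -> S -> R) (B : R) :
  (forall i o, 0 <= w i o) -> (forall i, \sum_o w i o = 1) ->
  (forall i o s, `|v i o s| <= B) ->
  exists2 c : I -> O, forall i, 0 < w i (c i) &
    \sum_s (\sum_i v i (c i) s - \sum_i \sum_o w i o * v i o s) ^+ 2 <=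
    #|I|%:R * (#|S|%:R * B ^+ 2).
Proof.
move=> w0 w1 vB; pose mu i s := \sum_o w i o * v i o s.
have pick i : exists o, 0 < w i o.
  have [|o wo _] := @weighted_min R O (w i) (fun=> 0) 0 (w0 i) (w1 i).
    by rewrite big1 // => o _; rewrite mulr0.
  by exists o.
(* The choices are fixed one index at a time: in expectation the cross term with [A s] vanishes and
   the variance is at most [B ^+ 2]. *)
have step i (A : S -> R) : exists2 o, 0 < w i o &
    \sum_s (A s + (v i o s - mu i s)) ^+ 2 <= \sum_s A s ^+ 2 + #|S|%:R * B ^+ 2.
  apply: weighted_min => //; under eq_bigr do rewrite mulr_sumr.
  have -> : #|S|%:R * B ^+ 2 = \sum_(s : S) B ^+ 2 by rewrite sumr_const mulr_natl.
  rewrite exchange_big -big_split /=.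
  apply: ler_sum => s _.
  rewrite (eq_bigr (fun o => w i o * (A s ^+ 2 - 2 * A s * mu i s + mu i s ^+ 2) +
    (w i o * v i o s * (2 * (A s - mu i s)) + w i o * v i o s ^+ 2))); last first.
    by move=> o _; ring.
  rewrite !big_split /= -!mulr_suml w1 -/(mu i s).
  have : \sum_o w i o * v i o s ^+ 2 <= B ^+ 2.
    rewrite -[leRHS]mul1r -(w1 i) mulr_suml; apply: ler_sum => o _.
    rewrite ler_wpM2l // -real_normK ?num_real //.
    by apply: lerXn2r => //; rewrite nnegrE // (le_trans _ (vB i o s)).
  have := sqr_ge0 (mu i s); lra.
have [c [cw cs]] : exists c : I -> O, (forall i, 0 < w i (c i)) /\
    \sum_s (\sum_(i <- enum I) (v i (c i) s - mu i s)) ^+ 2 <=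
    (size (enum I))%:R * (#|S|%:R * B ^+ 2).
  elim: (enum I) (enum_uniq I) => [_|i r IH /= /andP[ir /IH[c [cw cs]]]].
    exists (fun i => projT1 (cid (pick i))); split=> [i|]; first by case: (cid (pick i)).
    by rewrite mul0r big1 // => s _; rewrite big_nil expr0n.
  have [o wo os] := step i (fun s => \sum_(k <- r) (v k (c k) s - mu k s)).
  exists (fun k => if k == i then o else c k); split=> [k|].
    by case: eqP => [->|].
  rewrite -natr1 mulrDl mul1r.
  rewrite addrC; apply: le_trans (lerD (lexx _) cs); rewrite addrC; apply: le_trans os.
  rewrite le_eqVlt; apply/orP; left; apply/eqP; apply: eq_bigr => s _.
  rewrite big_cons eqxx addrC; congr ((_ + _) ^+ 2).
  by apply: eq_big_seq => k kr; rewrite (negPf (memPn ir k kr)).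
exists c => //; move: cs; rewrite -cardE; congr (_ <= _).
by apply: eq_bigr => s _; rewrite big_enum sumrB.
Qed.

Lemma induced_iso (A B : sgraph) (C : {set A}) (D : {set B}) (h : A -> B) :
  {in C &, injective h} -> h @: C = D ->
  {in C &, forall x y, adj (h x) (h y) = adj x y} ->
  graph_iso (induced C) (induced D).
Proof.
move=> hi hC ha; have hD x : x \in C -> h x \in D by move=> xC; rewrite -hC imset_f.
exists (fun x : induced C => Sub (h (val x)) (hD _ (valP x)) : induced D).
split=> [|x y]; last by rewrite /= /ind_adj /= ha //; apply: valP.
apply: inj_card_bij => [x y /(congr1 val) /= hxy|].
  by apply/val_inj/hi => //; apply: valP.
rewrite !card_sig (_ : #|_| = #|h @: C|); last by apply: eq_card => x; rewrite hC !inE.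
apply: leq_trans (leq_imset_card _ _) _.
by rewrite subset_leq_card //; apply/subsetP => x; rewrite !inE.
Qed.

(** * Pulling a partition back along local embeddings *)

Section Pullback.
Variables (d K1 K2 : nat) (X Y : sgraph) (aX : rel X) (aQ : rel Y).
Hypotheses (dY : max_degree_le d Y) (K1_gt0 : (0 < K1)%N).
Hypotheses (aXP : kpartition K1 aX) (aQP : kpartition K2 aQ).
Variables (g : Y -> Y -> X) (ok : pred Y).
Hypothesis gP : forall i, ok i ->
  exists u r, [/\ u \in kclass aQ i, (K2 < r)%N & liso r u (g i)].

Let rt := fingraph.root aQ.

(** All vertices of a piece use the embedding of its root [rt x]. With [connect aQ] in place of
    [aQ], every edge inside a piece may be kept; pieces without embedding fall apart into single
    vertices. *)
Definition pullback : rel Y := fun x y =>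
  [&& adj x y, connect aQ x y, ok (rt x) & aX (g (rt x) x) (g (rt x) y)].

Let aQ_sym : connect_sym aQ.
Proof. by apply: sym_connect_sym; case: aQP. Qed.

Lemma rt_eq x y : y \in kclass aQ x -> rt y = rt x.
Proof. by rewrite inE => xy; apply/esym/(fingraph.rootP aQ_sym). Qed.

Lemma kclass_rt x : kclass aQ (rt x) = kclass aQ x.
Proof.
apply: kclass_eq; first by case: aQP.
by rewrite inE connect_root.
Qed.

Section OnePiece.
Variable x : Y.
Hypothesis okx : ok (rt x).
Let h := g (rt x).
Let C := kclass aQ x.

Let lis : exists u r, [/\ C \subset ball_set K2 u, (K2 < r)%N & liso r u h].
Proof.
have [u [r [ui Kr lu]]] := gP okx; exists u, r; split=> //.
rewrite /C -(kclass_rt x) -(kclass_eq _ ui); last by case: aQP.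
exact: kclass_ball.
Qed.

Lemma piece_inj : {in C &, injective h}.
Proof.
have [u [r [Cu Kr /lisoP[hi _ _]]]] := lis; move=> y z yC zC; apply: hi.
  exact: (subsetP (ball_sub u (ltnW Kr))) (subsetP Cu y yC).
exact: (subsetP (ball_sub u (ltnW Kr))) (subsetP Cu z zC).
Qed.

Lemma piece_adj y z : y \in C -> adj (h y) z ->
  exists2 w, h w = z & adj y w.
Proof.
have [u [r [Cu Kr hP]]] := lis; have /lisoP[hi ha hb] := hP => yC yz.
have hyK : h y \in ball_set K2 (h u).
  have <- : h @: ball_set K2 u = ball_set K2 (h u).
    by apply: (liso_ball hP (ball_refl 0 u)); rewrite addn0 ltnW.
  by rewrite imset_f ?(subsetP Cu).
have : z \in ball_set r (h u).
  by apply: (subsetP (ball_sub _ Kr)); apply: ballS_adj yz.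
rewrite -hb => /imsetP[w wB zE]; exists w => //.
by rewrite -ha -?zE //; apply: (subsetP (ball_sub u (ltnW Kr))) (subsetP Cu y yC).
Qed.

Lemma piece_adjE y z : y \in C -> z \in C -> adj (h y) (h z) = adj y z.
Proof.
have [u [r [Cu Kr /lisoP[_ ha _]]]] := lis; move=> yC zC; apply: ha.
  exact: (subsetP (ball_sub u (ltnW Kr))) (subsetP Cu y yC).
exact: (subsetP (ball_sub u (ltnW Kr))) (subsetP Cu z zC).
Qed.

Lemma pullback_sub : kclass pullback x \subset C.
Proof.
apply/subsetP => y; rewrite inE; apply: (connect_inv (P := mem C)) => /=.
  exact: kclass_refl.
by move=> z w /=; rewrite !inE => xz /and4P[_ zw _ _]; apply: connect_trans zw.
Qed.

Lemma pullback_into y : y \in kclass pullback x -> h y \in kclass aX (h x).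
Proof.
rewrite inE => xy; rewrite inE.
have /andP[] // : (y \in C) && connect aX (h x) (h y).
apply: (connect_inv (P := fun y => (y \in C) && connect aX (h x) (h y))) xy => /=.
  by rewrite kclass_refl connect0.
move=> z w /andP[zC xz] /and4P[_ zw _]; rewrite (rt_eq zC) => azw.
rewrite (connect_trans xz (connect1 azw)) andbT; rewrite !inE in zC *.
exact: connect_trans zw.
Qed.

Lemma card_pullback : (#|kclass pullback x| <= K1)%N.
Proof.
have [_ _ aK] := aXP; apply: leq_trans (aK (h x)).
rewrite -(card_in_imset (f := h)); last first.
  by move=> y z /(subsetP pullback_sub) yC /(subsetP pullback_sub) zC; apply: piece_inj.
by apply/subset_leq_card/subsetP => z /imsetP[y yC ->]; apply: pullback_into.
Qed.

Hypothesis aQ_ind : {in ball_set K1 x, forall y, cut_degree aQ y = 0%N}.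

Let aQE y z : y \in ball_set K1 x -> adj y z -> aQ y z.
Proof.
move=> /aQ_ind/eqP; rewrite cards_eq0 => /eqP/setP/(_ z).
by rewrite !inE => /negbT; rewrite negb_and negbK => /orP[/negPf ->|].
Qed.

(** A path of [aX] from [h x] has at most [K1] steps once shortened. It lifts edge by edge and stays
    in the [K1]-ball of [x], where [aQ] cuts nothing, so the lift never leaves the piece. *)
Lemma pullback_image : h @: kclass pullback x = kclass aX (h x).
Proof.
have [aXs aXsub aXK] := aXP.
apply/eqP; rewrite eqEsubset; apply/andP; split.
  by apply/subsetP => z /imsetP[y yC ->]; apply: pullback_into.
apply/subsetP => z; rewrite inE => /connectP[p xp ->].
have [q xq uq _] := shortenP xp.
have sq : (size q <= K1)%N.
  apply: leq_trans (aXK (h x)); apply: leq_trans (_ : (size (h x :: q) <= _)%N) => //.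
  rewrite -(card_uniqP uq); apply/subset_leq_card/subsetP => w.
  by move=> wq; rewrite inE; apply: (path_connect xq).
suff [y [yk _ <-]] : exists y,
    [/\ y \in kclass pullback x, y \in ball_set (size q) x & h y = last (h x) q].
  exact: imset_f.
elim/last_ind: q xq sq {uq} => [|q w IH].
  by move=> _ _; exists x; rewrite kclass_refl ball_refl.
rewrite rcons_path size_rcons last_rcons => /andP[xq qw] sq.
have [y [yk yb yE]] := IH xq (ltnW sq).
have yC := subsetP pullback_sub y yk.
rewrite -yE in qw; have [v vE yv] := piece_adj yC (aXsub _ _ qw).
exists v; split=> //; last exact: ballS_adj yv.
rewrite !inE in yk *; apply: connect_trans yk (connect1 _).
rewrite /pullback (rt_eq yC) okx -/h vE qw yv !andbT.
by apply/connect1/aQE => //; apply: (subsetP (ball_sub x (ltnW sq))).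
Qed.

End OnePiece.

Lemma pullback_kpartition : kpartition K1 pullback.
Proof.
have [aQs aQsub _] := aQP; have [aXs _ _] := aXP; split.
- move=> x y; rewrite /pullback adj_sym aQ_sym; case: (boolP (connect aQ y x)) => //= yx.
  by rewrite (_ : rt x = rt y) 1?aXs //; apply: rt_eq; rewrite inE.
- by move=> x y /and4P[].
- move=> x; have [okx|okx] := boolP (ok (rt x)); first exact: card_pullback.
  rewrite (_ : kclass _ x = [set x]%SET) ?cards1 //.
  apply/setP => y; rewrite !inE; apply/idP/eqP => [|->]; last exact: connect0.
  move=> /(connect_inv (P := pred1 x)) /= H; apply/eqP/H => // z w /eqP ->.
  by rewrite /pullback (negPf okx) !andbF.
Qed.

Lemma pullback_cut_degree x : (cut_degree pullback x <= cut_degree aQ x +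
  (if ok (rt x) then cut_degree aX (g (rt x) x) else d))%N.
Proof.
have [okx|okx] := boolP (ok (rt x)); last first.
  apply: leq_trans (leq_addl _ _); apply: leq_trans (dY x).
  by apply/subset_leq_card/subsetP => y; rewrite !inE => /andP[].
set h := g (rt x); pose A := [set y | adj x y && ~~ aQ x y].
pose B := [set y in kclass aQ x | adj x y && ~~ aX (h x) (h y)].
apply: (@leq_trans #|A :|: B|).
  apply/subset_leq_card/subsetP => y; rewrite !inE /pullback okx /=.
  case/andP => -> /=; case: (boolP (aQ x y)) => //= xy.
  by rewrite (connect1 xy).
apply: leq_trans (leq_card_setU _ _) _; rewrite leq_add2l.
rewrite -(card_in_imset (f := h)); last first.
  move=> y z; rewrite !inE => /andP[yC _] /andP[zC _].
  by apply: (piece_inj okx); rewrite inE.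
apply/subset_leq_card/subsetP => z /imsetP[y + ->].
rewrite !inE => /andP[yC /andP[xy ->]]; rewrite andbT.
by rewrite (piece_adjE okx) ?kclass_refl ?inE.
Qed.

Lemma pullback_iso (FX : {set {set X}}) (FY : {set {set Y}}) (x : Y) :
  @adj (del_edges FX) =2 aX -> @adj (del_edges FY) =2 pullback ->
  ok (rt x) -> {in ball_set K1 x, forall y, cut_degree aQ y = 0%N} ->
  graph_iso (induced (component (x : del_edges FY)))
            (induced (component (g (rt x) x : del_edges FX))).
Proof.
move=> FXE FYE okx xin.
have cX (z : X) : component (z : del_edges FX) = kclass aX z.
  by apply/setP => w; rewrite !inE; apply: eq_connect.
have cY (z : Y) : component (z : del_edges FY) = kclass pullback z.
  by apply/setP => w; rewrite !inE; apply: eq_connect.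
rewrite cX cY; apply: (@induced_iso (del_edges FY) (del_edges FX) _ _ (g (rt x))).
- by move=> y z /(subsetP (pullback_sub x)) yC /(subsetP (pullback_sub x)) zC; apply: piece_inj.
- exact: pullback_image.
- move=> y z yk zk; rewrite FXE FYE /pullback.
  have yC := subsetP (pullback_sub x) y yk; have zC := subsetP (pullback_sub x) z zk.
  have yz : connect aQ y z.
    by rewrite !inE in yC zC; apply: connect_trans zC; rewrite aQ_sym.
  rewrite (rt_eq yC) okx yz /=; case E: (aX _ _); rewrite ?andbF // andbT.
  by rewrite -(piece_adjE okx) //; have [_ aXsub _] := aXP; rewrite (aXsub _ _ E).
Qed.

End Pullback.

Definition ctype (G : sgraph) (F : {set {set G}}) (S : sgraph) (x : G) : bool :=
  `[< graph_iso (induced (component (x : del_edges F))) S >].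

Lemma comp_freqE (R : realType) (G : sgraph) (F : {set {set G}}) (S : sgraph) :
  comp_freq R (del_edges F) S = (\sum_x (ctype F S x)%:R) / #|G|%:R.
Proof.
rewrite /comp_freq; congr (_ / _); rewrite -sum1_card natr_sum big_mkcond /=.
by apply: eq_bigr => x _; rewrite inE /ctype; case: `[< _ >].
Qed.

Lemma sum_roots (R : realType) (Y : sgraph) (a : rel Y) (h : Y -> R) : symmetric a ->
  \sum_(i | fingraph.root a i == i) \sum_(u in kclass a i) h u = \sum_u h u.
Proof.
move=> as_; have ac := sym_connect_sym as_.
rewrite (exchange_big_dep xpredT) //=; apply: eq_bigr => u _.
rewrite (big_pred1 (fingraph.root a u)) // => i /=; rewrite inE.
apply/andP/eqP => [[/eqP ri iu]|->]; first by rewrite -ri; apply/(fingraph.rootP ac).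
by rewrite (root_root ac) ac connect_root.
Qed.

Lemma card_diff_le (R : realType) (T : finType) (p q : T -> bool) (C : {set T}) :
  (forall x, x \notin C -> p x = q x) ->
  `|\sum_x (p x)%:R - \sum_x (q x)%:R| <= #|C|%:R :> R.
Proof.
move=> pq; rewrite -sumrB; apply: le_trans (ler_norm_sum _ _ _) _.
rewrite -sum1_card natr_sum [leRHS]big_mkcond /=; apply: ler_sum => x _.
case: ifP => [_|/negbT/pq ->]; last by rewrite subrr normr0.
by case: (p x); case: (q x); rewrite /= ?subrr ?mulr0n ?mulr1n ?subr0 ?sub0r ?normrN ?normr1 ?normr0 ?ler01.
Qed.

Lemma cut_degree_nbhd (d K : nat) (Y : sgraph) (a : rel Y) : max_degree_le d Y ->
  (#|[set x | ~~ [forall y in ball_set K x, cut_degree a y == 0%N]]|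
    <= d.+1 ^ K * cuts a)%N.
Proof.
move=> dY; set B := [set x | _].
have sub : B \subset \bigcup_(y | cut_degree a y != 0%N) ball_set K y.
  apply/subsetP => x; rewrite inE => /forall_inPn[y yx cy].
  by apply/bigcupP; exists y; rewrite // ball_sym.
apply: leq_trans (subset_leq_card sub) _.
apply: (@leq_trans (\sum_(y | cut_degree a y != 0%N) d.+1 ^ K)).
  elim/big_rec2: _ => [|y n A _ leA]; first by rewrite cards0.
  by apply: leq_trans (leq_card_setU _ _) (leq_add _ leA); apply: card_ball.
rewrite /cuts big_distrr /= [leqLHS]big_mkcond /=; apply: leq_sum => y _.
by case: ifP => //; rewrite -lt0n => c0; rewrite leq_pmulr.
Qed.

(** Cost and statistics of the new partition become sums of a function of the image [g (rt x) x],
    which is what a transfer can estimate. The errors come from pieces without embedding and from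
    vertices within [K1] of a cut edge. *)
Lemma pullback_stat (R : realType) (d K1 K2 : nat) (X Y : sgraph) (FX : {set {set X}})
    (aQ : rel Y) (g : Y -> Y -> X) (ok : pred Y) :
  max_degree_le d Y -> (0 < K1)%N -> components_le K1 (del_edges FX) ->
  kpartition K2 aQ ->
  (forall i, ok i -> exists u r, [/\ u \in kclass aQ i, (K2 < r)%N & liso r u (g i)]) ->
  let rt := fingraph.root aQ in
  exists FY : {set {set Y}}, [/\ FY \subset edges Y, components_le K1 (del_edges FY),
    2 * #|FY|%:R <= \sum_x (ok (rt x))%:R *
       (cut_degree (@adj (del_edges FX) : rel X) (g (rt x) x))%:R
       + (cuts aQ)%:R + d%:R * \sum_x (~~ ok (rt x))%:R :> R &
    forall S, `|\sum_x (ctype FY S x)%:R -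
        \sum_x (ok (rt x) && ctype FX S (g (rt x) x))%:R| <=
      \sum_x (~~ ok (rt x))%:R + (d.+1 ^ K1)%:R * (cuts aQ)%:R :> R].
Proof.
move=> dY K0 FXK aQP gP rt; pose aX : rel X := @adj (del_edges FX).
have aXP : kpartition K1 aX.
  split; last exact: FXK.
    by move=> x y; apply: (@adj_sym (del_edges FX)).
  by move=> x y; rewrite /aX adj_del_edges => /andP[].
have [FY [FYE FYc FYa]] := kpartition_edges (pullback_kpartition K0 aXP aQP gP).
exists FY; split=> //.
- move=> x; have [_ _ /(_ x)] := pullback_kpartition K0 aXP aQP gP.
  apply: leq_trans; apply/subset_leq_card/subsetP => y; rewrite !inE.
  by rewrite (eq_connect FYa).
- rewrite -natrM; apply: (@le_trans _ _ (cuts (pullback aX aQ g ok))%:R).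
    by rewrite ler_nat.
  rewrite /cuts !natr_sum mulr_sumr -!big_split /=; apply: ler_sum => x _.
  have := pullback_cut_degree aX dY aQP gP x; rewrite -/rt -(ler_nat R) natrD.
  by case: (ok (rt x)); rewrite /= ?mul1r ?mul0r ?mulr0 ?mulr1 ?addr0 ?add0r addrC.
- move=> S; pose C1 := [set x | ~~ ok (rt x)].
  pose C2 := [set x | ~~ [forall y in ball_set K1 x, cut_degree aQ y == 0%N]].
  apply: (@le_trans _ _ #|C1 :|: C2|%:R).
    apply: card_diff_le => x; rewrite !inE negb_or !negbK => /andP[okx /forall_inP xin].
    rewrite okx /=; apply: asbool_equiv_eq.
    have xx : {in ball_set K1 x, forall y, cut_degree aQ y = 0%N}.
      by move=> y /xin/eqP.
    have iso := pullback_iso aXP aQP gP (fun _ _ => erefl : adj (s := del_edges FX) _ _ = aX _ _) FYa okx xx.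
    by split; apply: graph_iso_trans; [apply: graph_iso_sym |].
  have C1E : \sum_x (~~ ok (rt x))%:R = #|C1|%:R :> R.
    rewrite -sum1_card natr_sum [RHS]big_mkcond; apply: eq_bigr => x _.
    by rewrite inE; case: (ok _).
  rewrite C1E -natrM -natrD ler_nat; apply: leq_trans (leq_card_setU _ _) _.
  by rewrite leq_add2l cut_degree_nbhd.
Qed.

Lemma sum_mem_mul (R : realType) (T : finType) (A : {set T}) (h : T -> R) :
  \sum_x (x \in A)%:R * h x = \sum_(x in A) h x.
Proof.
rewrite [RHS]big_mkcond; apply: eq_bigr => x _.
by case: (x \in A); rewrite /= ?mulr1n ?mulr0n ?mul1r ?mul0r.
Qed.

(* One random choice is made per piece: u uniform in the piece, then g uniform
   among the embeddings of the r-ball of u. Its expectation is transfer. *)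
Lemma choose_embeddings (R : realType) (X Y : sgraph) (K r : nat) (aQ : rel Y) (S : finType)
    (f : S -> X -> R) (err : R) :
  (0 < #|X|)%N -> kpartition K aQ -> (forall s y, 0 <= f s y <= 1) -> 0 < err ->
  #|S|%:R * K%:R ^+ 2 / err ^+ 2 <= #|Y|%:R ->
  exists (u : Y -> Y) (g : Y -> {ffun Y -> X}),
    (forall i, u i \in kclass aQ i) /\
    let ok i := g i \in Emb X r (u i) in let rt := fingraph.root aQ in
    forall s, `|\sum_x (ok (rt x))%:R * f s (g (rt x) x) -
       transfer (kclass aQ) r (f s)| <= err * #|Y|%:R.
Proof.
move=> X0 aQP f01 err0 Ybig; have [as_ _ aK] := aQP.
pose Q := kclass aQ; pose E u : {set {ffun Y -> X}} := Emb X r u.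
pose rt := fingraph.root aQ.
(* Where no embedding exists, all functions are drawn so that the weights still form a probability
   law; the factor [o.2 \in E o.1] in [v] then gives 0, the default value of [avg]. *)
pose Em u : {set {ffun Y -> X}} := if E u == set0 then setT else E u.
have Em0 u : 0 < #|Em u|%:R :> R.
  rewrite ltr0n card_gt0 /Em; case: ifP => [_|->] //.
  have /card_gt0P[x _] := X0; apply/set0Pn; exists [ffun=> x]; exact: in_setT.
have Q0 i : 0 < #|Q i|%:R :> R.
  by rewrite ltr0n; apply/card_gt0P; exists i; apply: kclass_refl.
pose w i (o : Y * {ffun Y -> X}) : R :=
  (o.1 \in Q i)%:R * ((o.2 \in Em o.1)%:R / #|Em o.1|%:R) / #|Q i|%:R.
(* The choices are indexed by all vertices but count only at roots, one per piece. *)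
pose v i (o : Y * {ffun Y -> X}) s : R :=
  (rt i == i)%:R * ((o.2 \in E o.1)%:R * \sum_(x in Q i) f s (o.2 x)).
have w0 i o : 0 <= w i o by rewrite /w !(mulr_ge0, divr_ge0, invr_ge0).
have wsum i (F : Y -> {ffun Y -> X} -> R) : \sum_o w i o * F o.1 o.2 =
    (\sum_(u in Q i) (\sum_(g in Em u) F u g) / #|Em u|%:R) / #|Q i|%:R.
  rewrite -(pair_bigA _ (fun u g => w i (u, g) * F u g)) /= mulr_suml -sum_mem_mul.
  apply: eq_bigr => u _; rewrite -sum_mem_mul mulr_suml mulr_suml mulr_sumr.
  by apply: eq_bigr => g _; rewrite /w /=; ring.
have w1 i : \sum_o w i o = 1.
  under eq_bigr do rewrite -[w _ _]mulr1.
  rewrite (wsum i (fun _ _ => 1)) (eq_bigr (fun=> 1)) => [|u _].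
    by rewrite sumr_const divff // gt_eqF.
  by rewrite sumr_const divff // gt_eqF.
have vK i o s : `|v i o s| <= K%:R.
  have s0 : 0 <= \sum_(x in Q i) f s (o.2 x).
    by apply: sumr_ge0 => x _; case/andP: (f01 s (o.2 x)).
  rewrite ger0_norm ?mulr_ge0 //.
  apply: (@le_trans _ _ (\sum_(x in Q i) f s (o.2 x))).
    rewrite /v mulrA ler_piMl // -natrM -[leRHS]/(1%:R) ler_nat.
    by case: (_ == _); case: (_ \in _).
  apply: (@le_trans _ _ #|Q i|%:R); last by rewrite ler_nat aK.
  by rewrite -sumr_const; apply: ler_sum => x _; case/andP: (f01 s (o.2 x)).
have [c cw cs] := rounding w0 w1 vK.
exists (fun i => (c i).1), (fun i => (c i).2).
have cQ i : (c i).1 \in Q i.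
  by apply: contraTT (cw i) => /negPf ciQ; rewrite /w ciQ !mul0r ltxx.
split=> // ok rt_ s; rewrite {}/rt_.
have chosen : \sum_i v i (c i) s = \sum_x (ok (rt x))%:R * f s ((c (rt x)).2 x).
  rewrite -[RHS](sum_roots _ as_) [RHS]big_mkcond; apply: eq_bigr => i _.
  rewrite /v -/rt; case: eqP => [ri|_]; rewrite /= ?mulr1n ?mulr0n ?mul0r // mul1r.
  rewrite mulr_sumr; apply: eq_bigr => x xi.
  have -> : rt x = i.
    by rewrite -ri; apply/esym/(fingraph.rootP (sym_connect_sym as_)); rewrite inE in xi.
  by [].
have expected : \sum_i \sum_o w i o * v i o s = transfer Q r (f s).
  rewrite /transfer -[RHS](sum_roots _ as_) [RHS]big_mkcond; apply: eq_bigr => i _.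
  rewrite (wsum i (fun u g => (rt i == i)%:R * ((g \in E u)%:R * \sum_(x in Q i) f s (g x)))).
  rewrite -/rt; case: ifP => ri; last first.
    rewrite big1 ?mul0r // => u _; rewrite big1 ?mul0r // => g _.
    by rewrite mulr0n mul0r.
  rewrite mulr_suml; apply: eq_bigr => u ui.
  rewrite (_ : Q u = Q i); last exact: kclass_eq.
  congr (_ / _); rewrite -avg_sum /avg -/(E u).
  rewrite /Em; have [->|E0] := eqVneq (E u) set0.
    by rewrite big_set0 mul0r big1 ?mul0r // => g _; rewrite in_set0 mulr0n mul0r mulr0.
  by congr (_ / _); apply: eq_bigr => g ->; rewrite !mulr1n !mul1r.
rewrite -/rt -chosen -/Q -expected -ler_sqr ?nnegrE ?mulr_ge0 ?(ltW err0) //.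
rewrite real_normK ?num_real // exprMn.
have : (\sum_i v i (c i) s - \sum_i \sum_o w i o * v i o s) ^+ 2 <=
    #|Y|%:R * (#|S|%:R * K%:R ^+ 2).
  apply: le_trans cs; rewrite (bigD1 s) //= lerDl; apply: sumr_ge0 => t _; exact: sqr_ge0.
move/le_trans; apply; rewrite ler_pdivrMr ?exprn_gt0 // in Ybig.
apply: le_trans (ler_wpM2l (ler0n _ _) Ybig) _.
by rewrite le_eqVlt; apply/orP; left; apply/eqP; ring.
Qed.

(** * Targets with many vertices *)

Section LargeGraph.
Variables (R : realType) (d : nat) (alpha : nat -> nat * rooted_graph).
Hypothesis halpha : enumerates_U d alpha.
Variable N : nat -> nat.
Hypothesis btype_lt : forall r (G : sgraph) (u : G), (0 < r)%N ->
  max_degree_le d G -> (btype alpha r u < N r)%N.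


(** The order of the quantifiers matters: [eps2] must be known before hyperfiniteness supplies [K2],
    and only then are [beta], [rmax] and [n0] fixed. The lower bound on the size concerns [Y] alone,
    where the rounding takes place. *)
Lemma large_case (K1 : nat) (eta : R) : (0 < K1)%N -> 0 < eta ->
  exists2 eps2 : R, 0 < eps2 & forall K2, exists (beta : R) (rmax n0 : nat),
  0 < beta /\ forall (X Y : sgraph) (FX : {set {set X}}) (aQ : rel Y),
    max_degree_le d X -> max_degree_le d Y -> (0 < #|X|)%N -> (0 < #|Y|)%N ->
    (n0 <= #|Y|)%N -> close_stat alpha N beta rmax Y X ->
    components_le K1 (del_edges FX) ->
    kpartition K2 aQ -> (cuts aQ)%:R <= eps2 * #|Y|%:R ->
  exists FY : {set {set Y}}, [/\ FY \subset edges Y, components_le K1 (del_edges FY),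
    2 * #|FY|%:R / #|Y|%:R <=
      (cuts (@adj (del_edges FX) : rel X))%:R / #|X|%:R + eta &
    forall n (E : {set {set 'I_n}}), (n <= K1)%N ->
      `|comp_freq R (del_edges FY) (graph_on E) -
        comp_freq R (del_edges FX) (graph_on E)| <= eta].
Proof.
move=> K10 eta0; set D1 : R := (d.+1 ^ K1)%:R.
have D11 : 1 <= D1 by rewrite ler1n expn_gt0.
have D10 : 0 < D1 by apply: lt_le_trans D11.
set d' : R := d.+1%:R; have d'1 : 1 <= d' by rewrite ler1n.
have d'0 : 0 < d' by apply: lt_le_trans d'1.
(* The vertices within [K1] of a cut edge then make up a proportion of at most [eta / 2]. *)
exists (eta / (2 * D1)); first by rewrite divr_gt0 // mulr_gt0.
move=> K2; pose err := eta / (8 * d').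
have err0 : 0 < err by rewrite divr_gt0 // mulr_gt0.
pose T : finType := option (option {n : 'I_K1.+1 & {set {set 'I_n}}}).
have [beta [L [b0 L0 tr]]] := transfer_mean halpha btype_lt K2 T err0.
exists beta, (scale K2 L), (Num.truncn (#|T|%:R * K2%:R ^+ 2 / err ^+ 2)).+1.
split=> // X Y FX aQ dX dY X0 Y0 Ybig cl FXK aQP aQc; have [as_ _ _] := aQP.
pose aX : rel X := @adj (del_edges FX).
(* The constant 1 measures the vertices whose piece has no embedding; the cut degree, scaled into
   the unit interval, gives the cost; the others are the component types. *)
pose f (s : T) (y : X) : R := match s with
  | None => 1
  | Some None => (cut_degree aX y)%:R / d'
  | Some (Some c) => (ctype FX (graph_on (tagged c)) y)%:R end.
have f01 s y : 0 <= f s y <= 1.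
  case: s => [[c|]|] /=; rewrite ?ler01 ?lexx // ?ler0n ?lern1 ?leq_b1 //.
  rewrite divr_ge0 ?ler0n // ler_pdivrMr // mul1r ler_nat.
  apply: leq_trans (leqnSn d); apply: leq_trans (dX y).
  by apply/subset_leq_card/subsetP => z; rewrite !inE => /andP[].
have Qb x : kclass aQ x \subset ball_set K2 x by apply: kclass_ball.
have [j jL trf] := tr X Y dX dY X0 Y0 cl (kclass aQ) (kclass_refl aQ)
  (fun x y => kclass_eq as_) Qb f f01.
move: trf; set r := (scale K2 j + K2)%N => trf.
have Kr : (K2 < r)%N by rewrite /r /scale addnAC addn1 ltnS leq_addl.
have Ybig' : #|T|%:R * K2%:R ^+ 2 / err ^+ 2 <= #|Y|%:R.
  by apply: ltW; apply: lt_le_trans (truncnS_gt _) _; rewrite ler_nat.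
have [u [g [uQ gf]]] := choose_embeddings r X0 aQP f01 err0 Ybig'.
pose ok i := g i \in Emb X r (u i); pose rt := fingraph.root aQ.
rewrite /= -/rt in gf.
have okP i : ok i -> exists u r, [/\ u \in kclass aQ i, (K2 < r)%N & liso r u (g i)].
  by move=> oki; exists (u i), r; split=> //; rewrite /ok inE in oki.
have [FY [FYE FYK FYc FYt]] := pullback_stat R dY K10 FXK aQP okP.
have nY : 0 < #|Y|%:R :> R by rewrite ltr0n.
have nX : 0 < #|X|%:R :> R by rewrite ltr0n.
pose A s := (\sum_x (ok (rt x))%:R * f s (g (rt x) x)) / #|Y|%:R.
pose M s := (\sum_y f s y) / #|X|%:R.
have AM s : `|A s - M s| <= 2 * err.
  rewrite (_ : A s - M s = (A s - transfer (kclass aQ) r (f s) / #|Y|%:R) +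
     (transfer (kclass aQ) r (f s) / #|Y|%:R - M s)); last by ring.
  apply: le_trans (ler_normD _ _) _; rewrite (_ : 2 * err = err + err); last by ring.
  apply: lerD; last exact: trf.
  by rewrite /A -mulrBl normrM (gtr0_norm (x := _^-1)) ?invr_gt0 // ler_pdivrMr.
pose bad : R := (\sum_x (~~ ok (rt x))%:R) / #|Y|%:R.
have badE : bad = 1 - A None.
  rewrite /bad /A -[X in X - _](divff (lt0r_neq0 nY)) -mulrBl; congr (_ / _).
  rewrite -sum1_card natr_sum -sumrB; apply: eq_bigr => x _ /=.
  by case: (ok _); rewrite /= ?mulr1n ?mulr0n ?mulr1 ?mul1r ?mul0r ?subrr ?subr0.
have M1 : M None = 1 by rewrite /M /= sumr_const divff ?gt_eqF.
have bad_le : bad <= 2 * err.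
  by have := AM None; rewrite badE M1 ler_norml => /andP[? ?]; lra.
have aQc' : (cuts aQ)%:R / #|Y|%:R <= eta / (2 * D1) by rewrite ler_pdivrMr.
have bad0 : 0 <= bad by rewrite divr_ge0 // sumr_ge0.
have errE : d' * (8 * err) = eta.
  by rewrite mulrA mulrC [d' * 8]mulrC /err divfK // gt_eqF // mulr_gt0.
have half : eta / (2 * D1) <= eta / 2.
  by rewrite ler_pM2l // lef_pV2 ?posrE ?mulr_gt0 // ler_peMr.
exists FY; split=> //.
  have -> : 2 * #|FY|%:R / #|Y|%:R = (2 * #|FY|%:R : R) / #|Y|%:R by [].
  have : (2 * #|FY|%:R : R) / #|Y|%:R <= d' * A (Some None) +
      (cuts aQ)%:R / #|Y|%:R + d%:R * bad.
    rewrite ler_pdivrMr // (le_trans FYc) // le_eqVlt; apply/orP; left; apply/eqP.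
    rewrite !mulrDl /A /bad !mulrA !divfK ?gt_eqF // mulr_sumr.
    congr (_ + _ + _); apply: eq_bigr => x _ /=.
    by rewrite mulrCA [d' * _]mulrC divfK ?gt_eqF.
  move/le_trans; apply.
  have MB : d' * M (Some None) = (cuts aX)%:R / #|X|%:R.
    by rewrite /M /= -mulr_suml -natr_sum mulrC mulrAC divfK ?gt_eqF.
  have AB : d' * A (Some None) <= d' * (M (Some None) + 2 * err).
    by rewrite ler_pM2l //; have := AM (Some None); rewrite ler_norml => /andP[? ?]; lra.
  have dbad : d%:R * bad <= d' * (2 * err).
    by apply: ler_pM => //; rewrite /d' ler_nat.
  have d'E : d' * (M (Some None) + 2 * err) = d' * M (Some None) + d' * (2 * err) by ring.
  have d'E2 : d' * (2 * err) = eta / 4 by rewrite -errE; field.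
  by rewrite -/aX; lra.
move=> n E nK; rewrite !comp_freqE.
have nK' : (n < K1.+1)%N by [].
pose c : T := Some (Some (Tagged (fun n : 'I_K1.+1 => {set {set 'I_n}}) (i := Ordinal nK') E)).
have FYt' := FYt (graph_on E).
have Ac : A c = (\sum_x (ok (rt x) && ctype FX (graph_on E) (g (rt x) x))%:R) / #|Y|%:R.
  rewrite /A; congr (_ / _); apply: eq_bigr => x _ /=.
  by case: (ok _); rewrite /= ?mulr1n ?mulr0n ?mul1r ?mul0r.
have := AM c; rewrite -[M c]/((\sum_x (ctype FX (graph_on E) x)%:R) / #|X|%:R).
set Mc := (_ / #|X|%:R) => AMc; set B := (_ / #|Y|%:R).
have BA : `|B - A c| <= bad + D1 * (eta / (2 * D1)).
  rewrite Ac /B -mulrBl normrM [X in _ * X](gtr0_norm (x := _^-1)) ?invr_gt0 //.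
  rewrite ler_pdivrMr //; apply: le_trans FYt' _.
  rewrite mulrDl /bad divfK ?gt_eqF // lerD2l -mulrA ler_wpM2l // ltW //.
have D1E : D1 * (eta / (2 * D1)) = eta / 2 by field; rewrite gt_eqF.
have err8 : 8 * err <= eta by rewrite -errE ler_peMl // mulr_ge0 // ltW.
rewrite (_ : B - Mc = (B - A c) + (A c - Mc)); last by ring.
by apply: le_trans (ler_normD _ _) _; lra.
Qed.

End LargeGraph.

(** * Small graphs *)

Section SmallGraphs.
Variables (R : realType) (d : nat) (alpha : nat -> nat * rooted_graph).
Hypothesis halpha : enumerates_U d alpha.
Variable N : nat -> nat.
Hypothesis btype_lt : forall r (G : sgraph) (u : G), (0 < r)%N ->
  max_degree_le d G -> (btype alpha r u < N r)%N.
Variable n0 : nat.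

(** Radius [n0] already sees the whole component; the pullback asks for a radius above the bound
    [n0] on the class sizes. *)
Local Notation bt := (btype alpha n0.+1).
Local Notation cc := (fun Y : sgraph => @kclass Y (@adj Y)).

Lemma cc_ball (Y : sgraph) (x : Y) : (#|Y| <= n0)%N -> cc Y x = ball_set n0 x.
Proof.
move=> Yn; apply/setP => y; apply/idP/idP => [|/ballP[p [xp <- _]]].
  rewrite inE; apply: connect_ball => //.
  by apply: leq_trans (max_card _) Yn.
by rewrite inE; apply/connectP; exists p.
Qed.

Lemma cc_eq (Y : sgraph) (x y : Y) : y \in cc Y x -> cc Y y = cc Y x.
Proof. by apply: kclass_eq; apply: adj_sym. Qed.

(* A canonical choice: isomorphic components get the same min_type. *)
Definition min_vertex (Y : sgraph) (x : Y) : Y := [arg min_(z < x in cc Y x) bt z].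

Definition min_type (Y : sgraph) (x : Y) : nat := bt (min_vertex x).

Lemma min_vertexP (Y : sgraph) (x : Y) : min_vertex x \in cc Y x /\
  forall z, z \in cc Y x -> (min_type x <= bt z)%N.
Proof.
rewrite /min_type /min_vertex; case: arg_minnP => [|z zx zmin]; first exact: kclass_refl.
by split.
Qed.

Lemma min_type_cc (Y : sgraph) (x y : Y) : y \in cc Y x -> min_type y = min_type x.
Proof.
move=> yx; apply/eqP; rewrite eqn_leq.
by rewrite (min_vertexP y).2 ?(min_vertexP x).2 // ?(cc_eq yx) ?(min_vertexP x).1 //
  -(cc_eq yx) (min_vertexP y).1.
Qed.

(** The minimal vertex is within [n0] of [x], so an isomorphism at radius [n0.+1 + n0] sees its
    [n0.+1]-ball. Thus ball statistics govern [min_type]. *)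
Lemma min_type_btype (A B : sgraph) (x : A) (y : B) :
  max_degree_le d A -> max_degree_le d B -> (#|A| <= n0)%N -> (#|B| <= n0)%N ->
  btype alpha (n0.+1 + n0) x = btype alpha (n0.+1 + n0) y -> min_type x = min_type y.
Proof.
suff le (A' B' : sgraph) (x' : A') (y' : B') :
    max_degree_le d A' -> max_degree_le d B' -> (#|A'| <= n0)%N -> (#|B'| <= n0)%N ->
    btype alpha (n0.+1 + n0) x' = btype alpha (n0.+1 + n0) y' ->
    (min_type y' <= min_type x')%N.
  by move=> dA dB An Bn xy; apply/eqP; rewrite eqn_leq !le.
move=> dA dB An Bn /(btype_eqP halpha) [] // g gP gx.
have [ux _] := min_vertexP x'; have [_ ymin] := min_vertexP y'.
rewrite (cc_ball _ An) in ux.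
have -> : min_type x' = bt (g (min_vertex x')).
  by apply/(btype_eqP halpha) => //; exists g => //; apply: (liso_restrict gP ux).
apply: ymin; rewrite (cc_ball _ Bn) -gx.
have <- : g @: ball_set n0 x' = ball_set n0 (g x').
  by apply: (liso_ball gP (ball_refl 0 x')); rewrite addn0 leq_addl.
exact: imset_f.
Qed.

Section Model.
Variables (X : sgraph) (V : nat -> X) (has_type : pred nat).
Hypotheses (dX : max_degree_le d X) (Xn : (#|X| <= n0)%N).
Hypothesis V_type : forall i, has_type i -> bt (V i) = i.

Definition model_mean (F : X -> R) (i : nat) : R :=
  (has_type i)%:R * ((\sum_(z in cc X (V i)) F z) / #|cc X (V i)|%:R).

Lemma card_cc_model (Y : sgraph) (x : Y) : max_degree_le d Y -> (#|Y| <= n0)%N ->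
  has_type (min_type x) -> exists g : Y -> X, [/\ liso n0.+1 (min_vertex x) g,
    {in cc Y x &, injective g} & g @: cc Y x = cc X (V (min_type x))].
Proof.
move=> dY Yn hx; have [ux _] := min_vertexP x.
have : bt (min_vertex x) = bt (V (min_type x)) by rewrite V_type.
move=> /(btype_eqP halpha) [] // g gP gu.
have xE : cc Y x = ball_set n0 (min_vertex x) by rewrite -(cc_eq ux) cc_ball.
exists g; split=> //.
  have /lisoP[gi _ _] := gP; rewrite xE => y z yB zB; apply: gi.
    exact: (subsetP (ball_sub _ (leqnSn n0))) yB.
  exact: (subsetP (ball_sub _ (leqnSn n0))) zB.
rewrite xE (cc_ball _ Xn) -gu; apply: (liso_ball gP (ball_refl 0 _)).
by rewrite addn0.
Qed.

(** The pieces are whole components and [aQ] cuts nothing, so the only loss comes from types without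
    a model, and no random choice is involved. *)
Lemma model_pullback (K1 : nat) (FX : {set {set X}}) (Y : sgraph) :
  max_degree_le d Y -> (#|Y| <= n0)%N -> (0 < #|X|)%N -> (0 < K1)%N ->
  components_le K1 (del_edges FX) ->
  exists FY : {set {set Y}}, [/\ FY \subset edges Y, components_le K1 (del_edges FY),
    2 * #|FY|%:R <= \sum_(x : Y) model_mean
        (fun z => (cut_degree (@adj (del_edges FX) : rel X) z)%:R) (min_type x)
      + d%:R * \sum_(x : Y) (~~ has_type (min_type x))%:R &
    forall S, `|\sum_x (ctype FY S x)%:R - \sum_(x : Y) model_mean
        (fun z => (ctype FX S z)%:R) (min_type x)| <=
      \sum_(x : Y) (~~ has_type (min_type x))%:R :> R].
Proof.
move=> dY Yn /card_gt0P[x0 _] K10 FXK.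
have gex (i : Y) : exists g : Y -> X, has_type (min_type i) ->
    [/\ liso n0.+1 (min_vertex i) g, {in cc Y i &, injective g} &
    g @: cc Y i = cc X (V (min_type i))].
  have [hi|hi] := boolP (has_type (min_type i)); last by exists (fun=> x0).
  by have [g gP] := card_cc_model dY Yn hi; exists g.
pose g (i : Y) : Y -> X := projT1 (cid (gex i)).
have gP (i : Y) : has_type (min_type i) ->
    [/\ liso n0.+1 (min_vertex i) (g i), {in cc Y i &, injective (g i)} &
    g i @: cc Y i = cc X (V (min_type i))] by apply: (projT2 (cid (gex i))).
pose ok (i : Y) := has_type (min_type i).
pose aQ : rel Y := @adj Y; pose rt := fingraph.root aQ.
have aQs : symmetric aQ by apply: adj_sym.
have aQP : kpartition n0 aQ.
  by split=> // x; apply: leq_trans (max_card _) Yn.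
have okP i : ok i -> exists u r, [/\ u \in kclass aQ i, (n0 < r)%N & liso r u (g i)].
  by move=> /gP[lg _ _]; exists (min_vertex i), n0.+1; split=> //; apply: (min_vertexP i).1.
have cuts0 : cuts aQ = 0%N.
  apply: big1 => x _; apply/eqP; rewrite cards_eq0; apply/eqP/setP => y.
  by rewrite !inE andbN.
have rt_cc x : rt x \in cc Y x by rewrite inE connect_root.
have okE x : ok (rt x) = has_type (min_type x) by rewrite /ok (min_type_cc (rt_cc x)).
have sumE (F : X -> R) : \sum_x (ok (rt x))%:R * F (g (rt x) x) =
    \sum_(x : Y) model_mean F (min_type x).
  rewrite -[LHS](sum_pieces (@kclass_refl Y aQ) (fun x y => kclass_eq aQs)).
  apply: eq_bigr => u _; rewrite /model_mean -(okE u).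
  rewrite (eq_bigr (fun x => (ok (rt u))%:R * F (g (rt u) x))) => [|x xu]; last first.
    have -> // : rt x = rt u.
    by apply/esym/(fingraph.rootP (sym_connect_sym aQs)); rewrite inE in xu.
  rewrite -mulr_sumr -mulrA; case: (boolP (ok (rt u))) => [oku|_]; last by rewrite !mul0r.
  have [_ gi gim] := gP _ oku; rewrite (min_type_cc (rt_cc u)) (cc_eq (rt_cc u)) in gi gim.
  by rewrite -gim big_imset //= card_in_imset.
have [FY [FYE FYK FYc FYt]] := pullback_stat R dY K10 FXK aQP okP.
exists FY; split=> //.
  rewrite -sumE; apply: le_trans FYc _; rewrite cuts0 addr0 lerD2l ler_wpM2l //.
  by apply: ler_sum => x _; rewrite -okE.
move=> S; rewrite -sumE.
have -> : \sum_x (ok (rt x))%:R * (ctype FX S (g (rt x) x))%:R =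
    \sum_x (ok (rt x) && ctype FX S (g (rt x) x))%:R :> R.
  apply: eq_bigr => x _.
  by case: (ok _); rewrite /= ?mulr1n ?mulr0n ?mul1r ?mul0r.
apply: le_trans (FYt S) _; rewrite cuts0 mulr0 addr0.
by apply: ler_sum => x _; rewrite -okE.
Qed.

End Model.
(* Rounding needs a large target. When both graphs are small, every component is
   instead partitioned like the cheapest component of G of the same type. *)
Lemma small_case (K1 : nat) (eta : R) : (0 < K1)%N -> 0 < eta ->
  exists (beta : R) (rmax : nat), 0 < beta /\ forall (G H : sgraph) (aG : rel G),
    max_degree_le d G -> max_degree_le d H -> (0 < #|G|)%N -> (0 < #|H|)%N ->
    (#|G| <= n0)%N -> (#|H| <= n0)%N -> close_stat alpha N beta rmax H G ->
    kpartition K1 aG ->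
  exists (FG : {set {set G}}) (FH : {set {set H}}),
    [/\ FG \subset edges G /\ FH \subset edges H,
      components_le K1 (del_edges FG) /\ components_le K1 (del_edges FH),
      2 * #|FG|%:R <= (cuts aG)%:R :> R,
      2 * #|FH|%:R / #|H|%:R <= (cuts aG)%:R / #|G|%:R + eta &
      forall S, `|comp_freq R (del_edges FG) S - comp_freq R (del_edges FH) S| <= eta].
Proof.
move=> K10 eta0; pose beta := eta / (2 * d.+1%:R).
have b0 : 0 < beta by rewrite divr_gt0 // mulr_gt0.
exists beta, (n0.+1 + n0)%N; split=> // G H aG dG dH G0 H0 Gn Hn cl aGP.
have nG : 0 < #|G|%:R :> R by rewrite ltr0n.
have nH : 0 < #|H|%:R :> R by rewrite ltr0n.
have [F0 [_ _ F0E]] := kpartition_edges aGP.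
have F0K : components_le K1 (del_edges F0).
  move=> x; have [_ _ /(_ x)] := aGP; apply: leq_trans.
  by apply/subset_leq_card/subsetP => y; rewrite !inE (eq_connect F0E).
pose has_type i := [exists v : G, bt v == i].
(* Among the components of [G] with a vertex of the given type, the model is one where [aG] cuts
   least; repartitioning [G] along the models does not raise its cost. *)
pose Phi (v : G) := \sum_(z in cc G v) cut_degree aG z.
have /card_gt0P[x0 _] := G0.
have Vex i : exists v : G, has_type i -> bt v = i /\
    forall w : G, bt w = i -> (Phi v <= Phi w)%N.
  have [/existsP[v vi]|hi] := boolP (has_type i); last by exists x0.
  exists [arg min_(w < v | bt w == i) Phi w] => _.
  by case: arg_minnP => // w /eqP wi wmin; split=> // w' /eqP; apply: wmin.
pose V i := projT1 (cid (Vex i)).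
have VP i : has_type i -> bt (V i) = i /\ forall w : G, bt w = i -> (Phi (V i) <= Phi w)%N.
  exact: (projT2 (cid (Vex i))).
have V_type i : has_type i -> bt (V i) = i by move=> /VP[].
pose cut z : R := (cut_degree (@adj (del_edges F0) : rel G) z)%:R.
have cutE z : cut z = (cut_degree aG z)%:R.
  by congr _%:R; apply: eq_card => y; rewrite !inE F0E.
(* [G] is repartitioned too, so that both statistics follow one function of [min_type]. *)
have [FG [FGE FGK FGc FGt]] := model_pullback dG Gn V_type dG Gn G0 K10 F0K.
have [FH [FHE FHK FHc FHt]] := model_pullback dG Gn V_type dH Hn G0 K10 F0K.
have hasG (x : G) : has_type (min_type x) by apply/existsP; exists (min_vertex x).
pose R' := (n0.+1 + n0)%N.
(* This expresses [min_type] through the ball type of radius [R'], read off from a representative in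
   [G] or, failing that, in [H]. *)
pose J j := if pselect (exists x : G, btype alpha R' x = j) is left e
  then min_type (projT1 (cid e))
  else if pselect (exists x : H, btype alpha R' x = j) is left e
  then min_type (projT1 (cid e)) else 0%N.
have JG (x : G) : J (btype alpha R' x) = min_type x.
  rewrite /J; case: pselect => [e|[]]; last by exists x.
  by apply: min_type_btype => //; apply: projT2 (cid e).
have JH (x : H) : J (btype alpha R' x) = min_type x.
  rewrite /J; case: pselect => [e|_].
    by apply: min_type_btype => //; apply: projT2 (cid e).
  case: pselect => [e|[]]; last by exists x.
  by apply: min_type_btype => //; apply: projT2 (cid e).
have transport (h : nat -> R) (B : R) : 0 <= B -> (forall i, `|h i| <= B) ->
    `|(\sum_(x : H) h (min_type x)) / #|H|%:R - (\sum_(x : G) h (min_type x)) / #|G|%:R|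
      <= beta * B.
  move=> B0 hB.
  have := mean_type_close (h := h \o J) btype_lt dG dH cl (r := R') _ B0 (fun i => hB (J i)).
  rewrite leqnn; under eq_bigr do rewrite /= JH.
  by under [X in _ - X / _]eq_bigr do rewrite /= JG; apply.
have mean_le (F : G -> R) (B : R) i : 0 <= B -> (forall z, 0 <= F z <= B) ->
    `|model_mean V has_type F i| <= B.
  move=> B0 FB; have c0 : 0 < #|cc G (V i)|%:R :> R.
    by rewrite ltr0n; apply/card_gt0P; exists (V i); apply: kclass_refl.
  have s0 : 0 <= (\sum_(z in cc G (V i)) F z) / #|cc G (V i)|%:R.
    by rewrite divr_ge0 // sumr_ge0 // => z _; case/andP: (FB z).
  rewrite /model_mean (ger0_norm (mulr_ge0 (ler0n R (has_type i)) s0)); case: (has_type i).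
    rewrite mul1r ler_pdivrMr // mulrC mulr_natl -sumr_const; apply: ler_sum => z _.
    by case/andP: (FB z).
  by rewrite mul0r.
have badG : \sum_(x : G) (~~ has_type (min_type x))%:R = 0 :> R.
  by apply: big1 => x _; rewrite hasG.
pose bad : R := (\sum_(x : H) (~~ has_type (min_type x))%:R) / #|H|%:R.
have bad_le : bad <= beta.
  have := transport (fun i => (~~ has_type i)%:R) 1 ler01.
  rewrite badG mul0r subr0 mulr1 => h; apply: le_trans (ler_norm _) (h _).
  by move=> k; case: (has_type k); rewrite ?normr0 ?normr1.
have d1 : 1 <= d.+1%:R :> R by rewrite ler1n.
have betaE : 2 * d.+1%:R * beta = eta by rewrite /beta mulrC divfK // gt_eqF // mulr_gt0.
have beta2 : 2 * beta <= eta by rewrite -betaE -mulrA ler_pM2l // ler_peMl // ltW.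
have cutG : \sum_(x : G) model_mean V has_type cut (min_type x) <= (cuts aG)%:R.
  rewrite /cuts natr_sum.
  rewrite -[leRHS](sum_pieces (@kclass_refl G (@adj G)) (fun x y => kclass_eq (@adj_sym G))).
  apply: ler_sum => x _; have [Vx Vmin] := VP _ (hasG x).
  have [g [_ gi gE]] := card_cc_model dG Gn V_type dG Gn (hasG x).
  rewrite /model_mean hasG mul1r -gE card_in_imset // gE ler_wpM2r ?invr_ge0 //.
  under eq_bigr do rewrite cutE; rewrite -!natr_sum ler_nat.
  apply: leq_trans (Vmin (min_vertex x) erefl) _.
  by rewrite /Phi (cc_eq (min_vertexP x).1).
exists FG, FH; split=> //.
- by apply: le_trans FGc _; rewrite badG mulr0 addr0.
- have -> : 2 * #|FH|%:R / #|H|%:R = (2 * #|FH|%:R : R) / #|H|%:R by [].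
  have : (2 * #|FH|%:R : R) / #|H|%:R <= (\sum_(x : H) model_mean V has_type cut (min_type x))
      / #|H|%:R + d%:R * bad.
    by rewrite /bad mulrA -mulrDl ler_wpM2r ?invr_ge0.
  move/le_trans; apply.
  have cutd z : 0 <= cut z <= d%:R.
    rewrite cutE ler0n ler_nat; apply: leq_trans (dG z).
    by apply/subset_leq_card/subsetP => w; rewrite !inE => /andP[].
  have := transport (model_mean V has_type cut) d%:R (ler0n _ _)
    (fun i => mean_le cut d%:R i (ler0n _ _) cutd).
  rewrite ler_norml => /andP[_ tr].
  have cG : (\sum_(x : G) model_mean V has_type cut (min_type x)) / #|G|%:R <=
      (cuts aG)%:R / #|G|%:R by rewrite ler_wpM2r ?invr_ge0.
  have dbad : d%:R * bad <= d%:R * beta by rewrite ler_wpM2l.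
  have : 2 * (d%:R * beta) <= eta.
    by rewrite -betaE -mulrA ler_pM2l // ler_wpM2r ?ltW // ltr_nat.
  lra.
- move=> S; rewrite !comp_freqE; pose F z : R := (ctype F0 S z)%:R.
  have F1 z : 0 <= F z <= 1 by rewrite ler0n lern1 leq_b1.
  have := transport (model_mean V has_type F) 1 ler01
    (fun i => mean_le F 1 i ler01 F1); rewrite mulr1 /F.
  have := FGt S; rewrite badG normr_le0 subr_eq0 => /eqP ->.
  set a := (X in `|X - _| <= beta); set b := (X in `|_ - X| <= beta) => ab.
  set c := (X in `|_ - X|).
  have ca : `|c - a| <= bad.
    rewrite /c /a /bad -mulrBl normrM [X in _ * X](gtr0_norm (x := _^-1)) ?invr_gt0 //.
    by rewrite ler_wpM2r ?invr_ge0 //; apply: FHt.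
  change (`|b - c| <= eta); move: ab ca; rewrite !ler_norml => /andP[? ?] /andP[? ?].
  by apply/andP; split; lra.
Qed.

End SmallGraphs.

(** * The theorem *)

Lemma eq_cuts (G : sgraph) (a b : rel G) : a =2 b -> cuts a = cuts b.
Proof.
by move=> ab; apply: eq_bigr => x _; apply: eq_card => y; rewrite !inE ab.
Qed.

(** The frequencies of [G] at radius 1 add up to 1, while division by 0 makes those of an empty
    graph vanish; the distance would be at least 1. *)
Lemma close_stat_nonempty (R : realType) (d : nat) (alpha : nat -> nat * rooted_graph)
    (N : nat -> nat) (beta : R) (rmax : nat) (G H : sgraph) :
  (forall r (G : sgraph) (u : G), (0 < r)%N -> max_degree_le d G ->
     (btype alpha r u < N r)%N) ->
  max_degree_le d G -> (0 < #|G|)%N -> (0 < rmax)%N -> beta < 1 ->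
  close_stat alpha N beta rmax G H -> (0 < #|H|)%N.
Proof.
move=> btN dG G0 r0 b1 /(_ 1%N r0) cl; rewrite lt0n; apply/eqP => H0.
move: b1; rewrite ltNge => /negP; apply; apply: le_trans cl.
have <- : (\sum_(x : G) 1) / #|G|%:R = 1 :> R.
  by rewrite sumr_const divff // pnatr_eq0 -lt0n.
rewrite (@sum_by_type R G (@btype alpha 1 G) (N 1%N) (fun=> 1)); last first.
  by move=> y; apply: btN.
rewrite mulr_suml; apply: ler_sum => i _.
by rewrite /tfreq H0 invr0 mulr0 subr0 mulr1 ler_norm.
Qed.

(** There is a margin: [m] is at most three quarters of [eps * #|G|], and [#|G| / 2] is one of the
    two terms of the budget. *)
Lemma edge_budget_gt (R : realType) (G : sgraph) (eps : R) (m : nat) :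
  0 < eps -> (0 < #|G|)%N -> 2 * m%:R / #|G|%:R <= eps + eps / 2 ->
  m%:R < 2 * eps * edge_budget R G.
Proof.
move=> e0 G0; have nG : 0 < #|G|%:R :> R by rewrite ltr0n.
rewrite ler_pdivrMr // => mG; apply: (@lt_le_trans _ _ (eps * #|G|%:R)).
  have : 0 < eps * #|G|%:R by rewrite mulr_gt0.
  lra.
have : #|G|%:R / 2 <= edge_budget R G by rewrite /edge_budget le_max lexx orbT.
rewrite -(ler_pM2l (_ : 0 < 2 * eps)); last by rewrite mulr_gt0.
by apply: le_trans; rewrite le_eqVlt; apply/orP; left; apply/eqP; field.
Qed.

Theorem theorem4 (R : realType) (d : nat) (hd : (1 <= d)%N)
    (alpha : nat -> nat * rooted_graph) (halpha : enumerates_U d alpha)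
    (dpi : (nat -> R) -> (nat -> R) -> R) (hdpi : product_metric_on_cube dpi)
    (P : sgraph -> Prop) (hPd : forall G : sgraph, P G -> max_degree_le d G)
    (hP : hyperfinite R P) :
  forall eps : R, 0 < eps ->
  exists K : nat, (0 < K)%N /\
  forall delta : R, 0 < delta ->
  exists f : R, 0 < f /\
  forall G H : sgraph, P G -> max_degree_le d H ->
    d_stat alpha dpi G H <= f ->
  exists (FG : {set {set G}}) (FH : {set {set H}}),
    [/\ FG \subset edges G /\ FH \subset edges H,
        #|FG|%:R < 2 * eps * edge_budget R G,
        #|FH|%:R < 2 * eps * edge_budget R H,
        components_le K (del_edges FG) /\ components_le K (del_edges FH) &
        comp_dist R K (del_edges FG) (del_edges FH) < delta].
Proof.
move=> eps eps0.
have [N btN] : exists N : nat -> nat, forall r (G : sgraph) (u : G), (0 < r)%N ->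
    max_degree_le d G -> (btype alpha r u < N r)%N.
  have Nex r : exists n, forall (G : sgraph) (u : G), (0 < r)%N ->
      max_degree_le d G -> (btype alpha r u < n)%N.
    case: (posnP r) => [-> | r0]; first by exists 0%N.
    by have [n nP] := btype_bounded halpha r0; exists n => G u _; apply: nP.
  by exists (fun r => projT1 (cid (Nex r))) => r; apply: (projT2 (cid (Nex r))).
have [K [b1 [r1 [K0 b10 stepA]]]] := hyperfinite_close halpha btN hPd hP eps0.
exists K; split=> // delta delta0.
pose C : R := \sum_(n < K.+1) \sum_(E in conn_reps n) 1.
have C0 : 0 <= C by apply: sumr_ge0 => n _; apply: sumr_ge0.
(* [eps / 2] leaves room for the strict edge bound; [C] counts the terms of [comp_dist], and [C + 1]
   makes the sum strictly smaller than [delta]. *)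
pose eta := Num.min (eps / 2) (delta / (C + 1)).
have eta0 : 0 < eta by rewrite lt_min !divr_gt0 // ltr_wpDl.
have etae : eta <= eps / 2 by rewrite /eta ge_min lexx.
have Ceta : C * eta < delta.
  apply: (@lt_le_trans _ _ ((C + 1) * eta)); first by rewrite ltr_pM2r // ltrDl.
  by rewrite mulrC -ler_pdivlMr ?ltr_wpDl // /eta ge_min lexx orbT.
have [eps2 eps20 large] := large_case halpha btN K0 eta0.
have [K2 [b2 [r2 [K20 b20 stepA2]]]] := hyperfinite_close halpha btN hPd hP eps20.
have [b3 [r3 [n0 [b30 {}large]]]] := large K2.
have [b4 [r4 [b40 small]]] := small_case halpha btN n0 K0 eta0.
(* The bound [1 / 2], and the successor in [rmax], are for [close_stat_nonempty]. *)
pose beta : R := Num.min (Num.min (Num.min b1 b2) (Num.min b3 b4)) (1 / 2).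
pose rmax := (maxn (maxn r1 r2) (maxn r3 r4)).+1.
have beta0 : 0 < beta by rewrite !lt_min b10 b20 b30 b40 divr_gt0.
have [f f0 fP] := d_stat_close halpha N hdpi rmax beta0.
exists f; split=> // G H GP dH GH; have dG := hPd G GP.
have cl : close_stat alpha N beta rmax G H by apply: fP.
have [ble1 ble2 ble3 ble4] : [/\ beta <= b1, beta <= b2, beta <= b3 & beta <= b4].
  by rewrite /beta !ge_min !lexx !orbT.
have [rle1 rle2 rle3 rle4] : [/\ (r1 <= rmax)%N, (r2 <= rmax)%N, (r3 <= rmax)%N & (r4 <= rmax)%N].
  by rewrite /rmax; split; apply/leqW; rewrite !leq_max leqnn ?orbT.
have [K' [_ /(_ G GP) [G0 _]]] := hyperfinite_kpartition hPd hP ltr01.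
have H0 : (0 < #|H|)%N.
  apply: close_stat_nonempty btN dG G0 _ _ cl => //.
  rewrite /beta; apply: (@le_lt_trans _ _ (1 / 2)); first by rewrite ge_min lexx orbT.
  lra.
have part (X : sgraph) : max_degree_le d X -> (0 < #|X|)%N ->
    close_stat alpha N beta rmax G X ->
    (exists2 a : rel X, kpartition K a & (cuts a)%:R <= eps * #|X|%:R) /\
    (exists2 a : rel X, kpartition K2 a & (cuts a)%:R <= eps2 * #|X|%:R).
  move=> dX X0 clX; split.
    by apply: stepA GP dX X0 _; apply: close_stat_le clX.
  by apply: stepA2 GP dX X0 _; apply: close_stat_le clX.
(* [G] is close to itself, so the same [K] and [K2] hold for both graphs. *)
have [[aG aGP aGc] [a2G a2GP a2Gc]] := part G dG G0 (@close_stat_refl alpha N R beta rmax G (ltW beta0)).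
have [[aH aHP aHc] [a2H a2HP a2Hc]] := part H dH H0 cl.
suff [FG [FH [FGE FHE FGc FHc [FGK FHK FF]]]] : exists (FG : {set {set G}}) (FH : {set {set H}}),
    [/\ FG \subset edges G, FH \subset edges H,
      2 * #|FG|%:R / #|G|%:R <= eps + eta, 2 * #|FH|%:R / #|H|%:R <= eps + eta &
      [/\ components_le K (del_edges FG), components_le K (del_edges FH) &
       forall n (E : {set {set 'I_n}}), (n <= K)%N ->
      `|comp_freq R (del_edges FG) (graph_on E) -
        comp_freq R (del_edges FH) (graph_on E)| <= eta]].
  exists FG, FH; split=> //.
  - by apply: edge_budget_gt => //; apply: le_trans FGc _; rewrite lerD2l.
  - by apply: edge_budget_gt => //; apply: le_trans FHc _; rewrite lerD2l.
  - apply: le_lt_trans Ceta; rewrite /C mulr_suml; apply: ler_sum => n _.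
    rewrite mulr_suml; apply: ler_sum => E _; rewrite mul1r; apply: FF.
    by rewrite -ltnS.
have dens (X : sgraph) (a : rel X) (F : {set {set X}}) : (0 < #|X|)%N ->
    (2 * #|F| <= cuts a)%N -> (cuts a)%:R <= eps * #|X|%:R ->
    2 * #|F|%:R / #|X|%:R <= eps + eta.
  move=> X0 Fa ac; rewrite ler_pdivrMr ?ltr0n //.
  apply: (@le_trans _ _ (cuts a)%:R); first by rewrite -natrM ler_nat.
  by apply: le_trans ac _; rewrite ler_pM2r ?ltr0n // lerDl ltW.
have ratio (X : sgraph) (a : rel X) : (0 < #|X|)%N -> (cuts a)%:R <= eps * #|X|%:R ->
    (cuts a)%:R / #|X|%:R + eta <= eps + eta.
  by move=> X0 ac; rewrite lerD2r ler_pdivrMr ?ltr0n.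
have comps (X : sgraph) (a : rel X) (F : {set {set X}}) :
    kpartition K a -> @adj (del_edges F) =2 a -> components_le K (del_edges F).
  move=> [_ _ aK] FE x; apply: leq_trans (aK x).
  by apply/subset_leq_card/subsetP => y; rewrite !inE (eq_connect FE).
have largeXY (X Y : sgraph) (a : rel X) (a2 : rel Y) :
    max_degree_le d X -> max_degree_le d Y -> (0 < #|X|)%N -> (0 < #|Y|)%N ->
    (n0 <= #|Y|)%N -> close_stat alpha N beta rmax Y X ->
    kpartition K a -> (cuts a)%:R <= eps * #|X|%:R ->
    kpartition K2 a2 -> (cuts a2)%:R <= eps2 * #|Y|%:R ->
    exists (FX : {set {set X}}) (FY : {set {set Y}}),
    [/\ FX \subset edges X, FY \subset edges Y,
      2 * #|FX|%:R / #|X|%:R <= eps + eta, 2 * #|FY|%:R / #|Y|%:R <= eps + eta &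
      [/\ components_le K (del_edges FX), components_le K (del_edges FY) &
       forall n (E : {set {set 'I_n}}), (n <= K)%N ->
      `|comp_freq R (del_edges FY) (graph_on E) -
        comp_freq R (del_edges FX) (graph_on E)| <= eta]].
  move=> dX dY X0 Y0 Yn clYX aP ac a2P a2c.
  have [FX [FXE FXc FXa]] := kpartition_edges aP.
  have FXK := comps X a FX aP FXa.
  have clYX' : close_stat alpha N b3 r3 Y X by apply: close_stat_le clYX.
  have [FY [FYE FYK FYc FYt]] := large X Y FX a2 dX dY X0 Y0 Yn clYX' FXK a2P a2c.
  exists FX, FY; split=> //; first exact: dens FXc ac.
  by apply: le_trans FYc _; rewrite (@eq_cuts X _ _ FXa); apply: ratio.
have [Gn|Gn] := leqP #|G| n0; last first.
  have [HG|HG] := leqP #|H| #|G|.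
    have [FH [FG [? ? ? ? [? ? ?]]]] := largeXY H G aH a2G dH dG H0 G0 (ltnW Gn) cl aHP aHc a2GP a2Gc.
    by exists FG, FH.
  have [FG [FH [? ? ? ? [? ? FF]]]] := largeXY G H aG a2H dG dH G0 H0 (ltnW (ltn_trans Gn HG))
    (close_stat_sym cl) aGP aGc a2HP a2Hc.
  by exists FG, FH; split=> //; split=> // n E nK; rewrite distrC; apply: FF.
have [Hn|Hn] := leqP #|H| n0; last first.
  have [FG [FH [? ? ? ? [? ? FF]]]] := largeXY G H aG a2H dG dH G0 H0 (ltnW Hn)
    (close_stat_sym cl) aGP aGc a2HP a2Hc.
  by exists FG, FH; split=> //; split=> // n E nK; rewrite distrC; apply: FF.
have cl4 : close_stat alpha N b4 r4 H G by apply: close_stat_le (close_stat_sym cl).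
have [FG [FH [[? ?] [? ?] FGc FHc FF]]] := small G H aG dG dH G0 H0 Gn Hn cl4 aGP.
exists FG, FH; split=> //.
- apply: le_trans (ratio G aG G0 aGc); apply: (@le_trans _ _ ((cuts aG)%:R / #|G|%:R)).
    by rewrite ler_wpM2r ?invr_ge0.
  by rewrite lerDl ltW.
- exact: le_trans FHc (ratio G aG G0 aGc).
Qed.
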